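(* Let $\epsilon'=\epsilon/(6c_\infty-\eta\iota)$, $\gamma_0=\min\Big\{\frac{1}{(2c_\infty-\eta\iota)^2},\frac{1}{9c_\infty^2}\Big\}$ (so $\gamma_0=O(c_\infty^{-2})$) and $$T=5+\frac{36}{\eta\sqrt{\gamma_0}\,\epsilon'}+\frac{648c_\infty^2}{\eta\epsilon}+\frac{28}{\eta\gamma_0\epsilon}=O\big(c_\infty^2\epsilon^{-2}\big).$$ Then the stopping condition of the PAM algorithm is satisfied within at most $T$ iterations, and the output pair $(\hat{\pmb\pi},\hat\lambda)$ of the PAM algorithm is an $\epsilon$-optimal solution of the EOT problem.
   Context: $\Delta^m$ is the probability simplex in $\mathbb{R}^m$; $[N]=\{1,\dots,N\}$. Let $n,N\ge1$, $\epsilon>0$, $a,b\in\Delta^n$ with $b_i>0$ for all $i$, and let $C^1,\dots,C^N\in\mathbb{R}^{n\times n}$ be cost matrices. Put $\|C\|_\infty=\max_{i,j}|C_{ij}|$, $c_\infty=\max_k\|C^k\|_\infty$, $\iota=\min_j\log b_j$. For a matrix $\pi$, $r(\pi)=\pi\mathbf 1$, $c(\pi)=\pi^\top\mathbf 1$ are its row and column sums, $\|\pi\|_1$ is the entrywise $\ell_1$ norm. EOT (equitable and optimal transport) problem: let $\Pi^N_{a,b}$ be the set of $\pmb\pi=(\pi^k)_{k\in[N]}$ with $\pi^k\in\mathbb{R}_{\ge0}^{n\times n}$, $r(\sum_k\pi^k)=a$, $c(\sum_k\pi^k)=b$, and $\ell(\pmb\pi,\lambda)=\sum_{k=1}^N\lambda_k\langle\pi^k,C^k\rangle$;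 the problem is $\min_{\pmb\pi\in\Pi^N_{a,b}}\max_{\lambda\in\Delta^N}\ell(\pmb\pi,\lambda)$. A pair $(\hat{\pmb\pi},\hat\lambda)\in\Pi^N_{a,b}\times\Delta^N$ is an $\epsilon$-optimal solution if $\max_{\lambda\in\Delta^N}\ell(\hat{\pmb\pi},\lambda)-\min_{\pmb\pi\in\Pi^N_{a,b}}\ell(\pmb\pi,\hat\lambda)\le\epsilon$. PAM (Projected Alternating Maximization) algorithm: let $$\eta=\min\Big\{\frac{\epsilon}{3(\log(n^2N)+1)},\,c_\infty\Big\},\qquad \tau=\eta/c_\infty^2 .$$ Let $\zeta^k(f,g,\lambda)$ be the matrix with entries $\exp((f_i+g_j-\lambda_kC^k_{ij})/\eta)$, $\pi^k(f,g,\lambda)=\zeta^k(f,g,\lambda)/\sum_{l=1}^N\|\zeta^l(f,g,\lambda)\|_1$, $\pmb\pi(f,g,\lambda)=(\pi^k(f,g,\lambda))_{k\in[N]}$, and $$F(f,g,\lambda)=\langle f,a\rangle+\langle g,b\rangle-\eta\log\Big(\sum_{k=1}^N\|\zeta^k(f,g,\lambda)\|_1\Big)-\eta .$$ Let $(f^*,g^*,\lambda^* )$ be a maximizer of $F$ over $\mathbb{R}^n\times\mathbb{R}^n\times\Delta^N$ and $\tilde F(f,g,\lambda)=F(f^*,g^*,\lambda^* )-F(f,g,\lambda)$. PAM starts from $f^0=g^0=(1,\dots,1)^\top$, $\lambda^0=(1/N,\dots,1/N)^\top$ and iterates (log and division entrywise) $$f^{t+1}=f^t+\eta\log\frac{a}{r(\sum_k\zeta^k(f^t,g^t,\lambda^t))},\quad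 g^{t+1}=g^t+\eta\log\frac{b}{c(\sum_k\zeta^k(f^{t+1},g^t,\lambda^t))},$$ $$\lambda^{t+1}=\mathrm{Proj}_{\Delta^N}\big(\lambda^t+\tau\nabla_\lambda F(f^{t+1},g^{t+1},\lambda^t)\big),$$ with $\mathrm{Proj}_{\Delta^N}$ the Euclidean projection onto $\Delta^N$. Put $c^t:=c\big(\sum_{k}\pi^k(f^{t+1},g^t,\lambda^t)\big)$. PAM stops at the first iteration $S\ge1$ with $$\|c^{S-1}-b\|_1\le\frac{\epsilon}{6(6c_\infty-\eta\iota)},\quad \|\lambda^S-\lambda^{S-1}\|_2\le\frac{\eta\epsilon}{18c_\infty^2},\quad \tilde F(f^S,g^{S-1},\lambda^{S-1})\le\frac{\epsilon}{6},$$ computes $(a^k,b^k)_{k\in[N]}=\mathrm{Margins}(\pmb\pi(f^S,g^{S-1},\lambda^{S-1}),a,b)$ and outputs $\hat{\pmb\pi}=(\hat\pi^k)_{k\in[N]}$ with $\hat\pi^k=\mathrm{Round}(\pi^k(f^S,g^{S-1},\lambda^{S-1}),a^k,b^k)$, and $\hat\lambda=\lambda^{S-1}$. Margins: given $\pmb\pi$ with $r(\sum_k\pi^k)=a$, $\mathrm{Margins}(\pmb\pi,a,b)$ returns $a^k=r(\pi^k)$ and vectors $b^k\in\mathbb{R}^n$ such that (i) $b^k\ge0$; (ii) $\sum_kb^k=b$; (iii) $\sum_ia^k_i=\sum_jb^k_j$ for all $k$; (iv) for each fixed $j$, $(b^k_j-[c(\pi^k)]_j)(b^{k'}_j-[c(\pi^{k'})]_j)\ge0$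 for all $k,k'$. They are built by starting from $b^k=c(\pi^k)+\frac1N\big(b-c(\sum_l\pi^l)\big)$ and, as long as some $b^k_j<0$, picking $j'$ with $b^k_{j'}>[c(\pi^k)]_{j'}$ and $k'$ with $b^{k'}_j>0$, and, with $\vartheta=\min\{|b^k_j|,|b^{k'}_j|,|b^k_{j'}-[c(\pi^k)]_{j'}|\}$, adding $\vartheta$ to $b^k_j$ and $b^{k'}_{j'}$ and subtracting $\vartheta$ from $b^k_{j'}$ and $b^{k'}_j$. $\mathrm{Round}(\pi,a,b)$ for $\pi\in\mathbb{R}^{n\times n}$, $a,b\in\mathbb{R}^n_+$: $\pi'=\mathrm{Diag}(x)\pi$ with $x_i=\min\{a_i/r(\pi)_i,1\}$; $\pi''=\pi'\,\mathrm{Diag}(y)$ with $y_j=\min\{b_j/c(\pi')_j,1\}$; $e_a=a-r(\pi'')$, $e_b=b-c(\pi'')$; output $\pi''+e_ae_b^\top/\|e_a\|_1$. *)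

(* Defs.v *)
(* MathComp / MathComp-Analysis *)
From HB Require Import structures.
From mathcomp Require Import all_boot all_order all_algebra.
From mathcomp Require Import all_classical all_reals all_analysis.
Set Implicit Arguments.
Unset Strict Implicit.
Unset Printing Implicit Defensive.
Import Order.TTheory GRing.Theory Num.Theory.
Import numFieldNormedType.Exports.
Local Open Scope classical_set_scope.
Local Open Scope ring_scope.

Definition simplex (R : realType) (m : nat) : set 'cV[R]_m :=
  [set x : 'cV[R]_m | (forall i, 0 <= x i 0) /\ \sum_i x i 0 = 1].

Definition norm1 (R : realType) (m n : nat) (A : 'M[R]_(m, n)) : R :=
  \sum_i \sum_j `|A i j|.

Definition norm2 (R : realType) (m : nat) (x : 'cV[R]_m) : R :=
  Num.sqrt (\sum_i x i 0 ^+ 2).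

Definition inner (R : realType) (m n : nat) (A B : 'M[R]_(m, n)) : R :=
  \sum_i \sum_j A i j * B i j.

Definition rsum (R : realType) (n : nat) (p : 'M[R]_n) : 'cV[R]_n :=
  p *m const_mx 1.

Definition csum (R : realType) (n : nat) (p : 'M[R]_n) : 'cV[R]_n :=
  p^T *m const_mx 1.

(* The simplex is nonempty, compact and convex (m >= 1), so the set is a
   singleton and the default value 0 is not used. *)
Definition proj_simplex (R : realType) (m : nat) (x : 'cV[R]_m) : 'cV[R]_m :=
  xget 0 [set p : 'cV[R]_m | simplex p /\
                           forall q, simplex q -> norm2 (x - p) <= norm2 (x - q)].

(* The default 0 of the iterated maximum is harmless since the entries are
   absolute values. *)
Definition cinf (R : realType) (n N : nat) (C : 'I_N -> 'M[R]_n) : R :=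
  \big[Num.max/0]_k \big[Num.max/0]_i \big[Num.max/0]_j `|C k i j|.

(* The default 0 of the iterated minimum is harmless since, for b in the simplex
   with positive entries, every ln (b j 0) is nonpositive. *)
Definition iota_min (R : realType) (n : nat) (b : 'cV[R]_n) : R :=
  \big[Num.min/0]_j ln (b j 0).

Section EOT.
Variables (R : realType) (n N : nat).
Implicit Types (a b f g : 'cV[R]_n) (l : 'cV[R]_N).
Implicit Types (C pi : 'I_N -> 'M[R]_n).

Definition couplings a b : set ('I_N -> 'M[R]_n) :=
  [set pi : 'I_N -> 'M[R]_n | [/\ forall k i j, 0 <= pi k i j,
                rsum (\sum_k pi k) = a & csum (\sum_k pi k) = b]].

Definition ell C pi l : R := \sum_k l k 0 * inner (pi k) (C k).

(* sup and inf are the max and min: ell is continuous and both sets are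
   nonempty and compact. *)
Definition eps_optimal C a b (eps : R) pi l : Prop :=
  [/\ couplings a b pi, simplex l &
      sup [set ell C pi l' | l' in @simplex R N] -
      inf [set ell C pi' l | pi' in couplings a b] <= eps].

Definition eta_ C (eps : R) : R :=
  Num.min (eps / (3 * (ln ((n ^ 2 * N)%:R) + 1))) (cinf C).

Definition tau_ C (eps : R) : R := eta_ C eps / cinf C ^+ 2.

Definition zeta C (eps : R) f g l (k : 'I_N) : 'M[R]_n :=
  \matrix_(i, j) expR ((f i 0 + g j 0 - l k 0 * C k i j) / eta_ C eps).

Definition zeta_mass C (eps : R) f g l : R :=
  \sum_k norm1 (zeta C eps f g l k).

Definition plan C (eps : R) f g l (k : 'I_N) : 'M[R]_n :=
  (zeta_mass C eps f g l)^-1 *: zeta C eps f g l k.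

Definition dualF a b C (eps : R) f g l : R :=
  inner f a + inner g b - eta_ C eps * ln (zeta_mass C eps f g l) - eta_ C eps.

Definition grad_l a b C (eps : R) f g l : 'cV[R]_N :=
  \col_k derive1 (fun s : R => dualF a b C eps f g (l + s *: delta_mx k 0)) 0.

Definition dualF_maximizer a b C (eps : R) fs gs ls : Prop :=
  simplex ls /\
  forall f g l, simplex l -> dualF a b C eps f g l <= dualF a b C eps fs gs ls.

Definition upd_f a C (eps : R) f g l : 'cV[R]_n :=
  \col_i (f i 0 +
          eta_ C eps * ln (a i 0 / rsum (\sum_k zeta C eps f g l k) i 0)).

Definition upd_g b C (eps : R) f g l : 'cV[R]_n :=
  \col_j (g j 0 +
          eta_ C eps * ln (b j 0 / csum (\sum_k zeta C eps f g l k) j 0)).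

Definition upd_l a b C (eps : R) f g l : 'cV[R]_N :=
  proj_simplex (l + tau_ C eps *: grad_l a b C eps f g l).

Fixpoint pam a b C (eps : R) (t : nat) : 'cV[R]_n * 'cV[R]_n * 'cV[R]_N :=
  if t is t'.+1 then
    let: (f, g, l) := pam a b C eps t' in
    let f' := upd_f a C eps f g l in
    let g' := upd_g b C eps f' g l in
    (f', g', upd_l a b C eps f' g' l)
  else (const_mx 1, const_mx 1, const_mx (N%:R)^-1).

Definition pam_f a b C (eps : R) (t : nat) : 'cV[R]_n := (pam a b C eps t).1.1.
Definition pam_g a b C (eps : R) (t : nat) : 'cV[R]_n := (pam a b C eps t).1.2.
Definition pam_l a b C (eps : R) (t : nat) : 'cV[R]_N := (pam a b C eps t).2.

Definition pam_plan a b C (eps : R) (S : nat) : 'I_N -> 'M[R]_n :=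
  plan C eps (pam_f a b C eps S) (pam_g a b C eps S.-1) (pam_l a b C eps S.-1).

(* (fs, gs, ls) is the maximizer through which the dual gap is measured;
   csum (\sum_k pam_plan a b C eps S k) is the vector c^(S-1). *)
Definition pam_stop_cond a b C (eps : R) fs gs ls (S : nat) : Prop :=
  [/\ norm1 (csum (\sum_k pam_plan a b C eps S k) - b)
        <= eps / (6 * (6 * cinf C - eta_ C eps * iota_min b)),
      norm2 (pam_l a b C eps S - pam_l a b C eps S.-1)
        <= eta_ C eps * eps / (18 * cinf C ^+ 2) &
      dualF a b C eps fs gs ls -
      dualF a b C eps (pam_f a b C eps S) (pam_g a b C eps S.-1)
                      (pam_l a b C eps S.-1) <= eps / 6].

Definition pam_stops_at a b C (eps : R) fs gs ls (S : nat) : Prop :=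
  [/\ (1 <= S)%N, pam_stop_cond a b C eps fs gs ls S &
      forall S', (1 <= S' < S)%N -> ~ pam_stop_cond a b C eps fs gs ls S'].

Definition margins_init pi b (k : 'I_N) : 'cV[R]_n :=
  csum (pi k) + (N%:R)^-1 *: (b - csum (\sum_m pi m)).

Definition margins_step pi (bk bk' : 'I_N -> 'cV[R]_n) : Prop :=
  exists (k k' : 'I_N) (j j' : 'I_n),
    let th := Num.min (Num.min `|bk k j 0| `|bk k' j 0|)
                      `|bk k j' 0 - csum (pi k) j' 0| in
    [/\ bk k j 0 < 0, csum (pi k) j' 0 < bk k j' 0, 0 < bk k' j 0 &
        forall m, bk' m = bk m +
          (if m == k then th *: (delta_mx j 0 - delta_mx j' 0)
           else if m == k' then th *: (delta_mx j' 0 - delta_mx j 0)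
           else 0)].

Inductive margins_reach pi b : ('I_N -> 'cV[R]_n) -> Prop :=
| margins_reach_init : margins_reach pi b (margins_init pi b)
| margins_reach_step bk bk' :
    margins_reach pi b bk -> margins_step pi bk bk' -> margins_reach pi b bk'.

(* A relation, as the choice of the indices k, j, j', k' is left open: bk is the
   result of some terminated run. *)
Definition margins pi b (ak bk : 'I_N -> 'cV[R]_n) : Prop :=
  [/\ forall k, ak k = rsum (pi k), margins_reach pi b bk &
      forall k j, 0 <= bk k j 0].

(* With x / 0 = 0, a zero row or column of p is scaled by 0 rather than 1, which
   gives the same matrix, and e_a = 0 makes the rank-one correction vanish. *)
Definition round_plan (p : 'M[R]_n) (a b : 'cV[R]_n) : 'M[R]_n :=
  let x := \row_i Num.min (a i 0 / rsum p i 0) 1 in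
  let p' := diag_mx x *m p in
  let y := \row_j Num.min (b j 0 / csum p' j 0) 1 in
  let p'' := p' *m diag_mx y in
  let ea := a - rsum p'' in
  let eb := b - csum p'' in
  p'' + (norm1 ea)^-1 *: (ea *m eb^T).

Definition pam_output a b C (eps : R) (S : nat) pih lh : Prop :=
  exists ak bk : 'I_N -> 'cV[R]_n,
    [/\ margins (pam_plan a b C eps S) b ak bk,
        forall k, pih k = round_plan (pam_plan a b C eps S k) (ak k) (bk k) &
        lh = pam_l a b C eps S.-1].

Definition eps' b C (eps : R) : R :=
  eps / (6 * cinf C - eta_ C eps * iota_min b).

Definition gamma0 b C (eps : R) : R :=
  Num.min ((2 * cinf C - eta_ C eps * iota_min b) ^+ 2)^-1
          (9 * cinf C ^+ 2)^-1.

Definition Tbound b C (eps : R) : R :=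
  5 + 36 / (eta_ C eps * Num.sqrt (gamma0 b C eps) * eps' b C eps)
    + 648 * cinf C ^+ 2 / (eta_ C eps * eps)
    + 28 / (eta_ C eps * gamma0 b C eps * eps).

End EOT.

(* Main.v *)
(* Each PAM iteration increases the dual function F: the g-step by eta times a
   relative entropy, hence by eta/2 |c^t - b|_1^2 (Pinsker), and the lambda-step
   by c_oo^2/(2 eta) |lambda^(t+1) - lambda^t|_2^2, because the gradient in lambda
   is (c_oo^2/eta)-Lipschitz (Hoeffding's lemma for the log-sum-exp).  Conversely,
   concavity of F bounds the dual gap after the f-step by a linear combination of
   these two residuals, as g^t and some optimal g oscillate by at most
   2 c_oo - eta iota.  So the gap d_t satisfies d_t^2 <= D (d_t - d_(t+1)) and
   decays like D/t; once it is below eps/6, each iteration with a large residual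
   costs a fixed amount of gap, so there are few of them.

   At the stopping time the Gibbs form of the plan turns the residuals into a
   primal-dual gap, up to an entropy term eta log(n^2 N) <= eps/3, and the sign
   condition kept by Margins makes the total rounding error at most
   |c^(S-1) - b|_1. *)
Require Import Defs.
From mathcomp Require Import all_boot all_order all_algebra.
From mathcomp Require Import all_classical all_reals all_analysis.
From mathcomp Require Import ring lra.
Import Order.TTheory GRing.Theory Num.Theory.
Import numFieldNormedType.Exports.
Local Open Scope classical_set_scope.
Local Open Scope ring_scope.

(** * Log-sum-exp and entropy inequalities on a finite set *)

Section ExponentialWeights.
Set Implicit Arguments.
Unset Strict Implicit.
Variables (R : realType) (I : finType).
Implicit Types (p q d : I -> R).

Lemma is_derive_bigsum (h : I -> R -> R) (dh : I -> R) (x : R) :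
  (forall i, is_derive x 1 (h i) (dh i)) ->
  is_derive x 1 (fun s => \sum_i h i s) (\sum_i dh i).
Proof.
move=> hd; have -> : (fun s => \sum_i h i s) = \sum_i h i.
  by apply/funext => s; rewrite fct_sumE.
by elim/big_ind2 : _ => // [|*]; [exact: is_derive_cst|exact: is_deriveD].
Qed.

Lemma MVT_le (f df : R -> R) (x M : R) : 0 <= x ->
  (forall s : R, is_derive s 1 f (df s)) -> (forall s : R, 0 <= s -> df s <= M) ->
  f x - f 0 <= M * x.
Proof.
move=> x0 fd dfM.
have fc : {within `[0, x], continuous f}.
  apply: continuous_subspaceT => s.
  apply/differentiable_continuous/derivable1_diffP.
  exact: (@ex_derive _ _ _ _ _ _ _ (fd s)).
have [c] := MVT_segment x0 (fun s _ => fd s) fc.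
by rewrite in_itv/= subr0 => /andP[c0 _] ->; rewrite ler_wpM2r ?dfM.
Qed.

Lemma exp_mean_gt0 p d : (forall i, 0 <= p i) -> \sum_i p i = 1 ->
  0 < \sum_i p i * expR (d i).
Proof.
move=> p0 p1; rewrite lt_def sumr_ge0 ?andbT; last first.
  by move=> i _; rewrite mulr_ge0 ?expR_ge0.
apply/eqP => /eqP; rewrite psumr_eq0; last first.
  by move=> i _; rewrite mulr_ge0 ?expR_ge0.
move=> /allP pe0; suff : \sum_i p i = 0 by rewrite p1 => /eqP; rewrite oner_eq0.
apply: big1 => i _; apply/eqP; have := pe0 i (mem_index_enum _).
by rewrite mulf_eq0 expR_eq0 orbF.
Qed.

(* The log-moment generating function has as second derivative the variance of
   [d] under a tilted law, which is at most [M ^+ 2]; integrate twice. *)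
Lemma hoeffding p d (M : R) : (forall i, 0 <= p i) -> \sum_i p i = 1 ->
  (forall i, `|d i| <= M) ->
  ln (\sum_i p i * expR (d i)) <= \sum_i p i * d i + M ^+ 2 / 2.
Proof.
move=> p0 p1 dM.
pose Z (m : nat) (s : R) := \sum_i p i * d i ^+ m * expR (s * d i).
have Zd m (s : R) : is_derive s 1 (Z m) (Z m.+1 s).
  apply: is_derive_bigsum => i.
  have -> : (fun s => p i * d i ^+ m * expR (s * d i)) =
     (p i * d i ^+ m) \*: (expR \o (d i \*: id)).
    by apply/funext => r /=; rewrite [d i *: _]mulrC.
  apply: is_derive_eq.
  rewrite /= -[d i *: s]/(d i * s) /GRing.scale /= exprSr [d i * s]mulrC; ring.
have Z0E s : Z 0%N s = \sum_i p i * expR (s * d i).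
  by apply: eq_bigr => i _; rewrite expr0 mulr1.
have Z0 s : 0 < Z 0%N s by rewrite Z0E; exact: exp_mean_gt0.
have Z00 : Z 0%N 0 = 1.
  by rewrite Z0E -[RHS]p1; apply: eq_bigr => i _; rewrite mul0r expR0 mulr1.
have Z10 : Z 1%N 0 = \sum_i p i * d i.
  by apply: eq_bigr => i _; rewrite mul0r expR0 mulr1.
have Z2 s : Z 2 s <= M ^+ 2 * Z 0%N s.
  rewrite Z0E mulr_sumr; apply: ler_sum => i _.
  rewrite [X in X * _]mulrC -mulrA ler_wpM2r ?mulr_ge0 ?expR_ge0//.
  by rewrite -real_normK ?num_real// lerXn2r ?nnegrE// (le_trans _ (dM i)).
pose r (s : R) := Z 1%N s / Z 0%N s.
have rd (s : R) : is_derive s 1 r (Z 2 s / Z 0%N s - r s ^+ 2).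
  have Z0n : Z 0%N s != 0 by rewrite gt_eqF.
  have /= -> : r = Z 1%N * (fun s => (Z 0%N s)^-1) by [].
  have iv := is_deriveV Z0n (Zd 0%N s).
  apply: is_derive_eq.
  rewrite /GRing.scale /= -[X in _ - X ^+ 2]/(Z 1%N s / Z 0%N s).
  by field; exact: Z0n.
have rM (s : R) : 0 <= s -> r s - r 0 <= M ^+ 2 * s.
  move=> s0; apply: (MVT_le s0 rd) => t _.
  rewrite lerBlDr (le_trans (y := M ^+ 2))// ?lerDl ?sqr_ge0//.
  by rewrite ler_pdivrMr.
(* [h] is the log-moment generating function minus its tangent at 0 and minus the parabola
   [M ^+ 2 / 2 * s ^+ 2]. By [rM] its derivative is nonpositive for [s >= 0], and [h 0 = 0]. *)
pose h := (@ln R \o Z 0%N) - (r 0 \*: id) - ((M ^+ 2 / 2) \*: (id ^+ 2)).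
have hd (s : R) : is_derive s 1 h (r s - r 0 - M ^+ 2 * s).
  have ld := is_derive1_ln (Z0 s).
  rewrite /h; apply: is_derive_eq.
  by rewrite /GRing.scale /= [_^-1 * _]mulrC -/(r 0) -/(r s); lra.
have := @MVT_le h _ 1 0 ler01 hd.
rewrite mul0r /h !fctE /= Z00 ln1 expr1n expr0n /= /GRing.scale /= !mulr0 !mulr1.
rewrite /r Z00 Z10 divr1 Z0E.
have -> : \sum_i p i * expR (1 * d i) = \sum_i p i * expR (d i).
  by apply: eq_bigr => i _; rewrite mul1r.
have H s : 0 <= s -> r s - r 0 - M ^+ 2 * s <= 0 by move=> /rM; lra.
rewrite /r Z00 Z10 divr1 in H.
by move=> /(_ H); lra.
Qed.

(** Jensen's inequality, from the tangent bound [1 + x <= expR x] centred at the mean [m]. *)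
Lemma mean_le_ln_mean_exp p d : (forall i, 0 <= p i) -> \sum_i p i = 1 ->
  \sum_i p i * d i <= ln (\sum_i p i * expR (d i)).
Proof.
move=> p0 p1; set m := \sum_i p i * d i.
rewrite -[leLHS]expRK ler_ln ?posrE ?expR_gt0 ?exp_mean_gt0//.
have -> : \sum_i p i * expR (d i) = expR m * \sum_i p i * expR (d i - m).
  by rewrite mulr_sumr; apply: eq_bigr => i _; rewrite mulrCA -expRD addrC subrK.
rewrite ler_peMr ?expR_ge0//.
have -> : 1 = \sum_i p i * (1 + (d i - m)).
  under eq_bigr do rewrite mulrDr mulr1 mulrBr.
  by rewrite big_split /= sumrB -mulr_suml p1 mul1r -/m /= subrr addr0.
by apply: ler_sum => i _; rewrite ler_wpM2l ?expR_ge1Dx.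
Qed.

(** Termwise from [ln x <= x - 1] at [x = q i / p i]; indices with [p i = 0] are treated apart. *)
Lemma gibbs p q : (forall i, 0 <= p i) -> (forall i, 0 < q i) ->
  \sum_i p i = 1 -> \sum_i q i = 1 ->
  \sum_i p i * ln (q i) <= \sum_i p i * ln (p i).
Proof.
move=> p0 q0 p1 q1.
suff : \sum_i p i * ln (q i) <= \sum_i (p i * ln (p i) + (q i - p i)).
  by rewrite big_split /= sumrB p1 q1 subrr addr0.
apply: ler_sum => i _; have := p0 i; rewrite le_eqVlt => /predU1P[<-|pi0].
  by rewrite !mul0r add0r subr0 ltW.
have h : ln (q i) - ln (p i) <= q i / p i - 1.
  rewrite -ln_div ?posrE// -[in leLHS](subrK 1 (q i / p i)) addrC.
  by rewrite le_ln1Dx// ltrBrDl subrr divr_gt0.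
have := ler_wpM2l (p0 i) h.
by rewrite !mulrBr mulr1 mulrCA divff ?gt_eqF// mulr1; lra.
Qed.

(* Duality: the relative entropy dominates [\sum_i b i * h i - ln Z] for every
   [h]; take [h] proportional to the sign of [b - c]. *)
Lemma pinsker (b c : I -> R) : (forall i, 0 < b i) -> (forall i, 0 < c i) ->
  \sum_i b i = 1 -> \sum_i c i = 1 ->
  (\sum_i `|b i - c i|) ^+ 2 / 2 <= \sum_i b i * ln (b i / c i).
Proof.
move=> b0 c0 b1 c1; set s := \sum_i `|b i - c i|.
have s0 : 0 <= s by exact: sumr_ge0.
pose h i := s * Num.sg (b i - c i).
have hs i : `|h i| <= s.
  rewrite /h normrM (ger0_norm s0) ler_piMr// normr_sg.
  by case: (_ != 0).
set Z := \sum_i c i * expR (h i).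
have Z0 : 0 < Z by apply: exp_mean_gt0 => // i; exact: ltW.
have := @hoeffding c h s (fun i => ltW (c0 i)) c1 hs; rewrite -/Z => ZM.
pose q i := c i * expR (h i) / Z.
have q0 i : 0 < q i by rewrite divr_gt0 ?mulr_gt0 ?expR_gt0.
have q1 : \sum_i q i = 1 by rewrite -mulr_suml divff ?gt_eqF.
have := gibbs (fun i => ltW (b0 i)) q0 b1 q1; rewrite /q.
have -> : \sum_i b i * ln (c i * expR (h i) / Z) =
    \sum_i (b i * ln (c i) + b i * h i - b i * ln Z).
  apply: eq_bigr => i _.
  by rewrite ln_div ?lnM ?posrE ?mulr_gt0 ?expR_gt0// expRK; ring.
have -> : \sum_i b i * ln (b i / c i) = \sum_i b i * ln (b i) - \sum_i b i * ln (c i).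
  by rewrite -sumrB; apply: eq_bigr => i _; rewrite ln_div ?posrE// mulrBr.
rewrite sumrB big_split/= -mulr_suml b1 mul1r.
have : \sum_i b i * h i - \sum_i c i * h i = s ^+ 2.
  rewrite -sumrB expr2 {2}/s mulr_sumr; apply: eq_bigr => i _.
  by rewrite -mulrBl /h mulrCA [_ * Num.sg _]mulrC -normrEsg.
by lra.
Qed.

(** Gibbs' inequality against the uniform law. *)
Lemma entropy_le p : (forall i, 0 < p i) -> \sum_i p i = 1 ->
  - \sum_i p i * ln (p i) <= ln #|I|%:R.
Proof.
move=> p0 p1.
have I0 : (0 < #|I|)%N.
  case: (posnP #|I|) => // /card0_eq I0; move: p1; rewrite big_pred0.
    by move=> /eqP; rewrite eq_sym oner_eq0.
  by move=> i; have := I0 i; rewrite inE.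
have I0' : 0 < #|I|%:R :> R by rewrite ltr0n.
have q1 : \sum_(i : I) #|I|%:R^-1 = 1 :> R.
  by rewrite sumr_const -[RHS](mulVf (lt0r_neq0 I0')) mulr_natr.
have := @gibbs p (fun=> #|I|%:R^-1) (fun i => ltW (p0 i)) _ p1 q1.
rewrite invr_gt0 => /(_ (fun=> I0')).
by rewrite -mulr_suml p1 mul1r lnV ?posrE// lerNl.
Qed.

End ExponentialWeights.

(** * Euclidean projection onto the simplex *)

Section SimplexProjection.
Set Implicit Arguments.
Unset Strict Implicit.
Variables (R : realType) (m : nat).
Implicit Types x p q : 'cV[R]_m.

Lemma norm2_ge0 x : 0 <= norm2 x.
Proof. exact: sqrtr_ge0. Qed.

Lemma sqr_norm2 x : norm2 x ^+ 2 = \sum_i x i 0 ^+ 2.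
Proof. by rewrite sqr_sqrtr// sumr_ge0// => i _; exact: sqr_ge0. Qed.

Lemma entry_le_norm2 x i : `|x i 0| <= norm2 x.
Proof.
rewrite -ler_sqr ?nnegrE ?norm2_ge0// sqr_norm2 real_normK ?num_real//.
by rewrite (bigD1 i)//= lerDl sumr_ge0// => j _; exact: sqr_ge0.
Qed.

Lemma simplex_le1 x i : simplex x -> 0 <= x i 0 <= 1.
Proof.
move=> [x0 x1]; rewrite x0 -x1 (bigD1 i)//= lerDl sumr_ge0// => j _; exact: x0.
Qed.

Lemma simplex_sum_dist_le2 p q : simplex p -> simplex q ->
  \sum_k `|p k 0 - q k 0| <= 2.
Proof.
move=> [p0 p1] [q0 q1]; rewrite -[2]/(1 + 1) -{1}p1 -q1 -big_split/=.
apply: ler_sum => k _; rewrite (le_trans (ler_normB _ _))//.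
by rewrite !ger0_norm.
Qed.

(* The Karush-Kuhn-Tucker form of the projection: threshold the entries at the
   level [th] for which they sum to one. *)
Lemma simplex_variational x : (0 < m)%N -> exists2 p, simplex p &
  forall q, simplex q -> \sum_k (x k 0 - p k 0) * (q k 0 - p k 0) <= 0.
Proof.
move=> m0; pose f (th : R) := \sum_k Num.max (x k 0 - th) 0.
pose B := \sum_k `|x k 0|; pose k0 := Ordinal m0.
have xB k : x k 0 <= B.
  rewrite (le_trans (ler_norm _))// /B (bigD1 k)//= lerDl sumr_ge0//.
have fB : f B = 0.
  by apply: big1 => k _; apply/max_idPr; rewrite subr_le0.
have fA : 1 <= f (x k0 0 - 1).
  rewrite /f (bigD1 k0)//= -[leLHS]addr0 lerD//.
    by rewrite subKr le_max lexx.
  by rewrite sumr_ge0// => k _; rewrite le_max lexx orbT.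
have fc : continuous f.
  apply: continuous_big => [|k _]; first exact: add_continuous.
  move=> s; apply: (@continuous_max R R^o (fun s => x k 0 - s) (cst 0)).
    by apply: continuousB; [exact: cst_continuous|exact: cvg_id].
  exact: cst_continuous.
have AB : x k0 0 - 1 <= B by rewrite lerBlDr (le_trans (xB _))// lerDl.
have [th _ fth] : exists2 th, th \in `[x k0 0 - 1, B] & f th = 1.
  apply: IVT => //; first exact: continuous_subspaceT.
  by rewrite fB ge_min ler01 orbT le_max fA.
pose p : 'cV[R]_m := \col_k Num.max (x k 0 - th) 0.
have p0 k : 0 <= p k 0 by rewrite mxE le_max lexx orbT.
have p1 : \sum_k p k 0 = 1.
  by rewrite -fth; apply: eq_bigr => k _; rewrite mxE.
exists p => // q [q0 q1].
(* Both [p] and [q] sum to one, so [th] may be subtracted from the first factor. That factor then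
   vanishes where [p k 0] is positive; elsewhere it is nonpositive, while [q k 0 - p k 0 = q k 0] is
   nonnegative. *)
have -> : \sum_k (x k 0 - p k 0) * (q k 0 - p k 0) =
    \sum_k (x k 0 - p k 0 - th) * (q k 0 - p k 0).
  under [RHS]eq_bigr do rewrite mulrBl.
  by rewrite sumrB -mulr_sumr sumrB q1 p1 subrr mulr0 subr0.
apply: sumr_le0 => k _; rewrite mxE.
have [h|h] := leP (x k 0 - th) 0; last by rewrite subKr subrr mul0r.
by rewrite !subr0 mulr_le0_ge0.
Qed.

(** The variational inequality gives the Pythagorean inequality [key], so [p] is the only nearest
    point; hence [xget] returns it and never its default. *)
Lemma proj_simplexP x : (0 < m)%N -> simplex (proj_simplex x) /\
  forall q, simplex q ->
    \sum_k (x k 0 - proj_simplex x k 0) * (q k 0 - proj_simplex x k 0) <= 0.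
Proof.
move=> m0; have [p sp vp] := simplex_variational x m0.
have key q : simplex q ->
    norm2 (x - p) ^+ 2 + norm2 (p - q) ^+ 2 <= norm2 (x - q) ^+ 2.
  move=> sq; rewrite !sqr_norm2 -subr_le0.
  have -> : \sum_i (x - p) i 0 ^+ 2 + \sum_i (p - q) i 0 ^+ 2 -
      \sum_i (x - q) i 0 ^+ 2 =
      2 * \sum_k (x k 0 - p k 0) * (q k 0 - p k 0).
    rewrite -big_split -sumrB mulr_sumr /=; apply: eq_bigr => i _.
    by rewrite !mxE; ring.
  by rewrite pmulr_rle0// vp.
suff -> : proj_simplex x = p by [].
have [] : [set p : 'cV[R]_m | simplex p /\
    forall q, simplex q -> norm2 (x - p) <= norm2 (x - q)] (proj_simplex x).
  apply: (@xgetI _ _ _ p); split => // q sq.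
  rewrite -ler_sqr ?nnegrE ?norm2_ge0// (le_trans _ (key _ sq))//.
  by rewrite lerDl sqr_ge0.
move: (proj_simplex x) => q sq /(_ _ sp) qp.
have pq : norm2 (p - q) ^+ 2 <= 0.
  have := key _ sq; move: qp; rewrite -ler_sqr ?nnegrE ?norm2_ge0//; lra.
apply/matrixP => i j; rewrite ord1.
have := entry_le_norm2 (p - q) i.
have -> : norm2 (p - q) = 0.
  by apply/eqP; rewrite -sqrf_eq0 eq_le pq sqr_ge0.
by rewrite normr_le0 !mxE subr_eq0 => /eqP.
Qed.

End SimplexProjection.

(** * Sequences whose square is controlled by their decrease *)

Section QuadraticDecrease.
Set Implicit Arguments.
Unset Strict Implicit.
Variables (R : realType) (u : nat -> R) (D : R).
Hypotheses (D0 : 0 < D) (u0 : forall t, 0 <= u t).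
Hypothesis (uD : forall t, u t ^+ 2 <= D * (u t - u t.+1)).

(** With [v = u t] the hypothesis reads [D * u t.+1 <= v * (D - v)]. If [v < D], the induction bound
    [t * v <= D] makes [(t + 1) * v * (D - v)] at most [D ^+ 2 - v ^+ 2]; otherwise that product is
    nonpositive. *)
Lemma quadratic_decrease_rate t : t%:R * u t <= D.
Proof.
elim: t => [|t IH]; first by rewrite mul0r ltW.
rewrite -(ler_pM2l D0) -natr1.
have : (t%:R + 1) * (u t ^+ 2) <= (t%:R + 1) * (D * (u t - u t.+1)).
  by rewrite ler_wpM2l// addr_ge0.
have := u0 t; set v := u t in IH *; set w := u t.+1; set s := t%:R in IH *.
move=> v0 h.
have s0 : 0 <= s by [].
suff : (s + 1) * (v * (D - v)) <= D * D by lra.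
have [Dv|vD] := leP D v.
  have : v * (D - v) <= 0 by rewrite mulr_ge0_le0// subr_le0.
  move=> /(mulr_ge0_le0 (addr_ge0 s0 ler01)) /le_trans; apply.
  by rewrite mulr_ge0// ltW.
have : (s * v) * (D - v) <= D * (D - v) by rewrite ler_wpM2r// subr_ge0 ltW.
have := sqr_ge0 v; rewrite expr2; lra.
Qed.

(* Past index [m0] the value is at most [e]; it can then lose [w] only
   [m1] times before becoming negative. *)
Lemma good_index_bound (good : nat -> Prop) (e w m0 m1 : R) :
  0 < w -> 0 < m0 -> D <= e * m0 -> D <= m1 * (m0 * w) ->
  (forall t, u t <= e -> good t \/ w <= u t - u t.+1) ->
  exists2 t, good t & t.+1%:R <= m0 + m1 + 2.
Proof.
move=> w0 m00 De Dm1 step; apply: contrapT => nogood.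
(* [m], and [q] below, round [m0] and [u m / w] up to strictly larger integers. Each rounding costs
   at most one, hence the [+ 2]. *)
pose m := (Num.truncn m0).+1.
have m0m : m0 < m%:R by exact: truncnS_gt.
have mm0 : m%:R <= m0 + 1 by rewrite -natr1 lerD2r truncn_le// ltW.
have small t : (m <= t)%N -> u t <= e.
  move=> mt; have tm : m0 < t%:R by rewrite (lt_le_trans m0m)// ler_nat.
  have e0 : 0 <= e by rewrite -(pmulr_lge0 _ m00) (le_trans (ltW D0)).
  rewrite -(ler_pM2l (lt_trans m00 tm)) (le_trans (quadratic_decrease_rate t))//.
  by rewrite (le_trans De)// mulrC ler_wpM2r// ltW.
pose q := (Num.truncn (u m / w)).+1.
have um : u m / w <= m1.
  rewrite ler_pdivrMr//.
  have h : m%:R * u m <= m1 * (m0 * w) := le_trans (quadratic_decrease_rate m) Dm1.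
  rewrite -(ler_pM2l m00); have := ler_wpM2r (u0 m) (ltW m0m); lra.
have uq : u m < q%:R * w by rewrite -ltr_pdivrMr// truncnS_gt.
have q1 : q%:R <= m1 + 1.
  by rewrite -natr1 lerD2r (le_trans _ um)// truncn_le// divr_ge0// ltW.
have bad i : (i < q)%N -> w <= u (m + i)%N - u (m + i).+1.
  move=> iq; have [g|//] := step _ (small _ (leq_addr i m)).
  case: nogood; exists (m + i)%N => //.
  apply: (@le_trans _ _ (m%:R + q%:R)); last by lra.
  by rewrite -natrD ler_nat -addnS leq_add2l.
have dec i : (i <= q)%N -> u (m + i)%N <= u m - i%:R * w.
  elim: i => [|i IH] iq; first by rewrite addn0 mul0r subr0.
  have := IH (ltnW iq); have := bad _ iq; rewrite addnS -natr1; lra.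
have := dec q (leqnn q); have := u0 (m + q)%N; lra.
Qed.

End QuadraticDecrease.

(** * Sums, marginals and pairings of matrices *)

Section MatrixSums.
Set Implicit Arguments.
Unset Strict Implicit.
Variables (R : realType) (n N : nat).
Implicit Types (M : 'I_N -> 'M[R]_n) (p : 'M[R]_n).

Lemma sumr_ord_gt0 m (h : 'I_m -> R) : (0 < m)%N -> (forall i, 0 < h i) ->
  0 < \sum_i h i.
Proof.
move=> m0 h0; rewrite (bigD1 (Ordinal m0))//= ltr_wpDr// sumr_ge0// => i _.
exact: ltW.
Qed.

(** Turns sums over costs, rows and columns into sums over one finite type, to which the
    exponential-weight lemmas apply. *)
Lemma sum_triple (G : 'I_N -> 'I_n -> 'I_n -> R) :
  \sum_k \sum_i \sum_j G k i j = \sum_x G x.1 x.2.1 x.2.2.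
Proof. by under eq_bigr do rewrite pair_big; rewrite pair_big. Qed.

Lemma rsumE p i : rsum p i 0 = \sum_j p i j.
Proof. by rewrite mxE; apply: eq_bigr => j _; rewrite mxE mulr1. Qed.

Lemma csumE p j : csum p j 0 = \sum_i p i j.
Proof. by rewrite mxE; apply: eq_bigr => i _; rewrite !mxE mulr1. Qed.

Lemma rsum_sumE M i : rsum (\sum_k M k) i 0 = \sum_k \sum_j M k i j.
Proof.
by rewrite rsumE exchange_big; apply: eq_bigr => j _; rewrite summxE.
Qed.

Lemma csum_sumE M j : csum (\sum_k M k) j 0 = \sum_k \sum_i M k i j.
Proof.
by rewrite csumE exchange_big; apply: eq_bigr => i _; rewrite summxE.
Qed.

Lemma norm1_vecE (v : 'cV[R]_n) : norm1 v = \sum_j `|v j 0|.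
Proof. by apply: eq_bigr => j _; rewrite big_ord1. Qed.

Lemma inner_vecE (v w : 'cV[R]_n) : inner v w = \sum_j v j 0 * w j 0.
Proof. by apply: eq_bigr => j _; rewrite big_ord1. Qed.

Lemma innerBl m' m (x y z : 'M[R]_(m', m)) :
  inner (x - y) z = inner x z - inner y z.
Proof.
rewrite -sumrB; apply: eq_bigr => i _; rewrite -sumrB; apply: eq_bigr => j _.
by rewrite !mxE mulrBl.
Qed.

Lemma innerBr m' m (x y z : 'M[R]_(m', m)) :
  inner x (y - z) = inner x y - inner x z.
Proof.
rewrite -sumrB; apply: eq_bigr => i _; rewrite -sumrB; apply: eq_bigr => j _.
by rewrite !mxE mulrBr.
Qed.

Lemma inner0l m' m (x : 'M[R]_(m', m)) : inner 0 x = 0.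
Proof.
by apply: big1 => i _; apply: big1 => j _; rewrite mxE mul0r.
Qed.

Lemma midrange (v : 'cV[R]_n) D : (0 < n)%N ->
  (forall i j, v i 0 - v j 0 <= D) -> exists m, forall i, `|v i 0 - m| <= D / 2.
Proof.
move=> n0 vD; pose i0 := Ordinal n0.
have [i _ vi] := @arg_maxP _ _ _ i0 xpredT (fun i => v i 0) isT.
have [j _ vj] := @arg_minP _ _ _ i0 xpredT (fun i => v i 0) isT.
exists ((v i 0 + v j 0) / 2) => k; rewrite ler_norml.
have := vi k isT; have := vj k isT; have := vD i j; rewrite /=.
by move=> ? ? ?; apply/andP; split; lra.
Qed.

(** Since [w] sums to zero, [v] may be recentred at its midrange, which halves the oscillation in
    Hoelder's inequality. *)
Lemma inner_centered_le (v w : 'cV[R]_n) D : (0 < n)%N ->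
  (forall i j, v i 0 - v j 0 <= D) -> \sum_j w j 0 = 0 ->
  inner v w <= D / 2 * norm1 w.
Proof.
move=> n0 /(midrange n0)[m vm] w0; rewrite inner_vecE norm1_vecE.
have -> : \sum_j v j 0 * w j 0 = \sum_j (v j 0 - m) * w j 0.
  by under [RHS]eq_bigr do rewrite mulrBl; rewrite sumrB -mulr_sumr w0 mulr0 subr0.
rewrite mulr_sumr; apply: ler_sum => j _; rewrite (le_trans (ler_norm _))//.
by rewrite normrM ler_wpM2r.
Qed.

End MatrixSums.

(** * Rounding a positive matrix whose row sums already meet their target *)

Section Rounding.
Set Implicit Arguments.
Unset Strict Implicit.
Variables (R : realType) (n : nat) (p : 'M[R]_n) (b : 'cV[R]_n).
Hypotheses (n0 : (0 < n)%N) (p0 : forall i j, 0 < p i j).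
Hypotheses (b0 : forall j, 0 <= b j 0) (bp : \sum_j b j 0 = \sum_i rsum p i 0).

Let y (j : 'I_n) : R := Num.min (b j 0 / csum p j 0) 1.
Let ea (i : 'I_n) : R := \sum_j p i j * (1 - y j).
Let eb (j : 'I_n) : R := b j 0 - csum p j 0 * y j.
Let E : R := \sum_i ea i.

Let c0 j : 0 < csum p j 0.
Proof. by rewrite csumE sumr_ord_gt0. Qed.

Let y01 j : 0 <= y j <= 1.
Proof. by rewrite /y ge_min lexx orbT andbT le_min ler01 andbT divr_ge0// ltW. Qed.

Let ea0 i : 0 <= ea i.
Proof.
apply: sumr_ge0 => j _; rewrite mulr_ge0 ?(ltW (p0 _ _))// subr_ge0.
by case/andP: (y01 j).
Qed.

Let eb0 j : 0 <= eb j.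
Proof. by rewrite subr_ge0 mulrC -ler_pdivlMr// ge_min lexx. Qed.

Let E0 : 0 <= E. Proof. exact: sumr_ge0. Qed.

Let sum_col : \sum_j csum p j 0 * (1 - y j) = E.
Proof.
rewrite /E exchange_big; apply: eq_bigr => j _.
by rewrite -mulr_suml csumE.
Qed.

Let sum_eb : \sum_j eb j = E.
Proof.
rewrite sumrB bp -sum_col.
under [RHS]eq_bigr do rewrite mulrBr mulr1.
rewrite sumrB; congr (_ - _).
under eq_bigr do rewrite rsumE.
by rewrite exchange_big; apply: eq_bigr => j _; rewrite csumE.
Qed.

(** Handles the division by [norm1 ea]: when [E = 0] both error vectors vanish, so the convention
    for the inverse of 0 does no harm. *)
Let divfE_id (r : R) : (E = 0 -> r = 0) -> E^-1 * (r * E) = r.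
Proof.
have [->|E1] := eqVneq E 0; first by move=> ->; rewrite // mul0r mulr0.
by move=> _; rewrite mulrCA mulVf// mulr1.
Qed.

(** The row target is [rsum p] itself, so the row scaling is the identity; what remains is the
    column scaling and the rank-one correction. *)
Lemma round_planE i j :
  round_plan p (rsum p) b i j = p i j * y j + E^-1 * (ea i * eb j).
Proof.
rewrite /round_plan.
have -> : (\row_i Num.min (rsum p i 0 / rsum p i 0) 1) = const_mx 1 :> 'rV[R]_n.
  apply/matrixP => i' j'; rewrite [LHS]mxE [RHS]mxE divff ?minxx//.
  by rewrite rsumE gt_eqF ?sumr_ord_gt0.
rewrite diag_const_mx mul1mx.
set q := p *m _.
have qE i' j' : q i' j' = p i' j' * y j' by rewrite /q mul_mx_diag [LHS]mxE [X in _ * X]mxE.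
have eaE i' : (rsum p - rsum q) i' 0 = ea i'.
  rewrite mxE [X in _ + X]mxE !rsumE -sumrB; apply: eq_bigr => j' _.
  by rewrite qE mulrBr mulr1.
have ebE j' : (b - csum q) j' 0 = eb j'.
  rewrite mxE [X in _ + X]mxE csumE /eb csumE mulr_suml; congr (_ - _).
  by apply: eq_bigr => i' _; rewrite qE.
have -> : norm1 (rsum p - rsum q) = E.
  by rewrite norm1_vecE; apply: eq_bigr => i' _; rewrite eaE ger0_norm.
by rewrite mxE qE; congr (_ + _); rewrite mxE mxE big_ord1 eaE mxE ebE.
Qed.

Lemma round_plan_ge0 i j : 0 <= round_plan p (rsum p) b i j.
Proof.
rewrite round_planE addr_ge0// ?mulr_ge0 ?invr_ge0 ?(ltW (p0 _ _))//.
by case/andP: (y01 j).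
Qed.

Lemma rsum_round_plan : rsum (round_plan p (rsum p) b) = rsum p.
Proof.
apply/matrixP => i i'; rewrite ord1 rsumE.
under eq_bigr do rewrite round_planE.
rewrite big_split /= -!mulr_sumr sum_eb divfE_id => [|EE].
  by rewrite rsumE -big_split; apply: eq_bigr => j _ /=; ring.
have /allP/(_ i (mem_index_enum _))/eqP// : all (fun i => ea i == 0) (index_enum 'I_n).
by have := psumr_eq0 (index_enum 'I_n) (fun i (_ : xpredT i) => ea0 i); rewrite -/E EE eqxx.
Qed.

Lemma csum_round_plan : csum (round_plan p (rsum p) b) = b.
Proof.
apply/matrixP => j j'; rewrite ord1 csumE.
under eq_bigr do rewrite round_planE.
rewrite big_split /= -mulr_sumr -mulr_suml -mulr_suml -/E [E * _]mulrC divfE_id => [|EE].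
  by rewrite /eb csumE; ring.
have /allP/(_ j (mem_index_enum _))/eqP// : all (fun j => eb j == 0) (index_enum 'I_n).
by have := psumr_eq0 (index_enum 'I_n) (fun i (_ : xpredT i) => eb0 i); rewrite sum_eb EE eqxx.
Qed.

(** The column scaling removes mass [E] and the correction adds mass [E]. In each column either
    nothing is removed or nothing is missing afterwards, so the column discrepancies also sum to
    [E + E]. *)
Lemma round_plan_dist_le :
  \sum_i \sum_j `|round_plan p (rsum p) b i j - p i j| <=
  \sum_j `|b j 0 - csum p j 0|.
Proof.
have -> : \sum_j `|b j 0 - csum p j 0| = E + E.
  rewrite -{1}sum_col -sum_eb -big_split; apply: eq_bigr => j _ /=.
  rewrite /eb /y; have [h|h] := leP (b j 0 / csum p j 0) 1.
    rewrite ler0_norm; last by move: h; rewrite ler_pdivrMr// mul1r subr_le0.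
    by field; rewrite gt_eqF.
  rewrite ger0_norm; last by move: h; rewrite ltr_pdivlMr// mul1r subr_ge0 => /ltW.
  by ring.
apply: (@le_trans _ _ (\sum_i \sum_j (p i j * (1 - y j) + E^-1 * (ea i * eb j)))).
  apply: ler_sum => i _; apply: ler_sum => j _; rewrite round_planE.
  have -> : p i j * y j + E^-1 * (ea i * eb j) - p i j =
     E^-1 * (ea i * eb j) - p i j * (1 - y j) by ring.
  rewrite (le_trans (ler_normB _ _))// addrC !ger0_norm// ?mulr_ge0 ?invr_ge0//.
  - by rewrite ltW.
  - by rewrite subr_ge0; case/andP: (y01 j).
under eq_bigr do rewrite big_split /= -!mulr_sumr sum_eb.
rewrite big_split /= lerD2l -mulr_sumr -mulr_suml -/E.
by rewrite divfE_id.
Qed.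

End Rounding.

(** * The Margins procedure: invariant, a terminating run, total error *)

Section Margins.
Set Implicit Arguments.
Unset Strict Implicit.
Variables (R : realType) (n N : nat) (pi : 'I_N -> 'M[R]_n) (b : 'cV[R]_n).
Hypotheses (N0 : (0 < N)%N) (pi0 : forall k i j, 0 <= pi k i j).
Hypotheses (b0 : forall j, 0 < b j 0).
Hypothesis (bpi : \sum_j b j 0 = \sum_j csum (\sum_k pi k) j 0).
Implicit Types bk : 'I_N -> 'cV[R]_n.

(** Properties (ii), (iii) and (iv) of Margins, kept by every step; nonnegativity only holds at
    termination. The sign condition is put columnwise: either all [k] are in excess or all are in
    deficit. *)
Definition margins_inv bk :=
  [/\ forall j, \sum_k bk k j 0 = b j 0,
      forall k, \sum_j bk k j 0 = \sum_j csum (pi k) j 0 &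
      forall j, (forall k, csum (pi k) j 0 <= bk k j 0) \/
                (forall k, bk k j 0 <= csum (pi k) j 0)].

Let csum0 k j : 0 <= csum (pi k) j 0.
Proof. by rewrite csumE sumr_ge0. Qed.

Lemma sum_csum j : \sum_k csum (pi k) j 0 = csum (\sum_k pi k) j 0.
Proof. by rewrite csum_sumE; apply: eq_bigr => k _; rewrite csumE. Qed.

(** The column discrepancy is split evenly over [k], so all shares have its sign; the discrepancies
    cancel over columns by equality of the total masses. *)
Lemma margins_init_inv : margins_inv (margins_init pi b).
Proof.
have E k j : margins_init pi b k j 0 =
    csum (pi k) j 0 + N%:R^-1 * (b j 0 - csum (\sum_m pi m) j 0).
  rewrite mxE; congr (_ + _); rewrite mxE; congr (_ * _).
  by rewrite mxE; congr (_ + _); rewrite mxE.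
have N1 : N%:R != 0 :> R by rewrite pnatr_eq0 -lt0n.
split=> [j|k|j].
- under eq_bigr do rewrite E.
  rewrite big_split /= sumr_const card_ord sum_csum -[X in _ + X]mulr_natl mulrA divff//.
  by rewrite mul1r addrC subrK.
- under eq_bigr do rewrite E.
  by rewrite big_split /= -mulr_sumr sumrB bpi subrr mulr0 addr0.
- have [h|/ltW h] := leP (csum (\sum_m pi m) j 0) (b j 0); [left|right] => k.
    by rewrite E lerDl mulr_ge0 ?invr_ge0// subr_ge0.
  by rewrite E gerDl mulr_ge0_le0 ?invr_ge0// subr_le0.
Qed.

Section Step.
Variables (bk : 'I_N -> 'cV[R]_n) (k k' : 'I_N) (j j' : 'I_n).
Hypotheses (inv : margins_inv bk) (bkj : bk k j 0 < 0).
Hypotheses (bkj' : csum (pi k) j' 0 < bk k j' 0) (bk'j : 0 < bk k' j 0).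

Let th := Num.min (Num.min `|bk k j 0| `|bk k' j 0|)
                  `|bk k j' 0 - csum (pi k) j' 0|.

Definition margins_next m : 'cV[R]_n := bk m +
  (if m == k then th *: (delta_mx j 0 - delta_mx j' 0)
   else if m == k' then th *: (delta_mx j' 0 - delta_mx j 0) else 0).

Lemma margins_step_next : margins_step pi bk margins_next.
Proof. by exists k, k', j, j'. Qed.

Let kk' : k != k'.
Proof. by apply/eqP => kk; move: bk'j; rewrite -kk ltNge (ltW bkj). Qed.

Let jj' : j != j'.
Proof.
apply/eqP => jj; move: bkj'; rewrite -jj ltNge.
by rewrite (le_trans (ltW bkj)).
Qed.

Let th0 : 0 <= th.
Proof. by rewrite !le_min !normr_ge0. Qed.

Let th_le1 : th <= - bk k j 0.
Proof. by rewrite -(ltr0_norm bkj) !ge_min lexx. Qed.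

Let th_le2 : th <= bk k' j 0.
Proof. by rewrite -[leRHS](gtr0_norm bk'j) !ge_min lexx orbT. Qed.

Let th_le3 : th <= bk k j' 0 - csum (pi k) j' 0.
Proof.
have h : 0 < bk k j' 0 - csum (pi k) j' 0 by rewrite subr_gt0.
by rewrite -[leRHS](gtr0_norm h) ge_min lexx orbT.
Qed.

Lemma margins_next_cases :
  [\/ th = - bk k j 0, th = bk k' j 0 | th = bk k j' 0 - csum (pi k) j' 0].
Proof.
have h : 0 < bk k j' 0 - csum (pi k) j' 0 by rewrite subr_gt0.
rewrite /th (ltr0_norm bkj) (gtr0_norm bk'j) (gtr0_norm h).
case: (leP (Num.min _ _)) => _; last by constructor 3.
by case: leP => _; [constructor 1|constructor 2].
Qed.

(** In product form the update visibly preserves every row and column total, each factor having sum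
    zero. *)
Lemma margins_nextE m x : margins_next m x 0 = bk m x 0 +
  th * ((m == k)%:R - (m == k')%:R) * ((x == j)%:R - (x == j')%:R).
Proof.
rewrite mxE; congr (_ + _); have [->|mk] := eqVneq m k.
  by rewrite (negbTE kk') !mxE !andbT /=; ring.
have [_|mk'] := eqVneq m k'; first by rewrite !mxE !andbT /=; ring.
by rewrite mxE /=; ring.
Qed.

Let nextkj : margins_next k j 0 = bk k j 0 + th.
Proof. by rewrite margins_nextE !eqxx (negbTE kk') (negbTE jj') /=; ring. Qed.

Let nextkj' : margins_next k j' 0 = bk k j' 0 - th.
Proof.
by rewrite margins_nextE !eqxx (negbTE kk') eq_sym (negbTE jj') /=; ring.
Qed.

Let nextk'j : margins_next k' j 0 = bk k' j 0 - th.
Proof.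
by rewrite margins_nextE !eqxx [k' == k]eq_sym (negbTE kk') (negbTE jj') /=; ring.
Qed.

Let nextk'j' : margins_next k' j' 0 = bk k' j' 0 + th.
Proof.
rewrite margins_nextE !eqxx [k' == k]eq_sym [j' == j]eq_sym.
by rewrite (negbTE kk') (negbTE jj') /=; ring.
Qed.

Let next_row m x : m != k -> m != k' -> margins_next m x 0 = bk m x 0.
Proof. by move=> /negbTE mk /negbTE mk'; rewrite margins_nextE mk mk' /=; ring. Qed.

Let next_col m x : x != j -> x != j' -> margins_next m x 0 = bk m x 0.
Proof. by move=> /negbTE mk /negbTE mk'; rewrite margins_nextE mk mk' /=; ring. Qed.

Let col_j m : bk m j 0 <= csum (pi m) j 0.
Proof.
have [_ _ /(_ j)[h|->//]] := inv.
by have := h k; rewrite leNgt (lt_le_trans bkj).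
Qed.

Let col_j' m : csum (pi m) j' 0 <= bk m j' 0.
Proof.
have [_ _ /(_ j')[->//|h]] := inv.
by have := h k; rewrite leNgt bkj'.
Qed.

(** The negative entry puts column [j] on the deficit side, and the chosen excess puts [j'] on the
    other. The caps in [th] stop [(k, j)] at zero and [(k, j')] at its original margin; the two
    changes in row [k'] go the right way. *)
Lemma margins_next_inv : margins_inv margins_next.
Proof.
have delta1 m (x : 'I_m) : \sum_(z < m) (z == x)%:R = 1 :> R.
  rewrite (bigD1 x)//= eqxx big1 ?addr0// => z /negbTE -> //.
have [i1 i2 i3] := inv; split=> [x|m|x].
- under eq_bigr do rewrite margins_nextE.
  by rewrite big_split /= i1 -mulr_suml -mulr_sumr sumrB !delta1 subrr mulr0 mul0r addr0.
- under eq_bigr do rewrite margins_nextE.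
  by rewrite big_split /= i2 -mulr_sumr sumrB !delta1 subrr mulr0 addr0.
have [->|xj] := eqVneq x j.
  right=> m; have [->|mk] := eqVneq m k.
    by rewrite nextkj (le_trans _ (csum0 _ _))//; have := th_le1; lra.
  have [->|mk'] := eqVneq m k'; last by rewrite next_row.
  by rewrite nextk'j (le_trans _ (col_j k'))// gerBl.
have [->|xj'] := eqVneq x j'; last first.
  by have [h|h] := i3 x; [left|right] => m; rewrite next_col.
left=> m; have [->|mk] := eqVneq m k.
  by rewrite nextkj'; have := th_le3; lra.
have [->|mk'] := eqVneq m k'; last by rewrite next_row.
by rewrite nextk'j' (le_trans (col_j' k'))// lerDl.
Qed.

(** Only [(k', j)] and [(k, j')] decrease, and [th] is at most the former and at most the excess of
    the latter. *)
Lemma margins_next_neg m x : margins_next m x 0 < 0 -> bk m x 0 < 0.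
Proof.
have [->|xj] := eqVneq x j.
  have [->//|mk] := eqVneq m k.
  have [->|mk'] := eqVneq m k'; last by rewrite next_row.
  by rewrite nextk'j; have := th_le2; lra.
have [->|xj'] := eqVneq x j'; last by rewrite next_col.
have [->|mk] := eqVneq m k.
  by rewrite nextkj'; have := th_le3; have := csum0 k j'; lra.
have [->|mk'] := eqVneq m k'; last by rewrite next_row.
by rewrite nextk'j'; have := th0; lra.
Qed.

Let measure (bk : 'I_N -> 'cV[R]_n) :=
  (#|[set m | (0 < bk m j 0)%R]%SET| +
   #|[set x | (csum (pi k) x 0 < bk k x 0)%R]%SET|)%N.

(** [th] equals one of three quantities. The first would clear [(k, j)]; the second makes [(k', j)]
    zero and the third makes the excess at [(k, j')] zero. Neither set gains an element, since
    [(k, j)] stays negative. *)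
Lemma margins_next_measure : margins_next k j 0 < 0 ->
  (measure margins_next < measure bk)%N.
Proof.
move=> nkj.
have s1 : [set m | 0 < margins_next m j 0]%SET \subset [set m | 0 < bk m j 0]%SET.
  apply/fintype.subsetP => m; rewrite !inE.
  have [->|mk] := eqVneq m k; first by rewrite ltNge (ltW nkj).
  by have [->//|mk'] := eqVneq m k'; rewrite ?next_row.
have s2 : [set x | csum (pi k) x 0 < margins_next k x 0]%SET \subset
    [set x | csum (pi k) x 0 < bk k x 0]%SET.
  apply/fintype.subsetP => x; rewrite !inE.
  have [->|xj] := eqVneq x j.
    by move=> /(le_lt_trans (csum0 k j)); rewrite ltNge (ltW nkj).
  by have [->//|xj'] := eqVneq x j'; rewrite ?next_col.
case: margins_next_cases => th_eq.
- by move: nkj; rewrite nextkj th_eq subrr ltxx.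
- rewrite -addSn leq_add ?subset_leq_card// proper_card//.
  apply/properP; split=> //; exists k'; rewrite inE//.
  by rewrite nextk'j th_eq subrr ltxx.
- rewrite -addnS leq_add ?subset_leq_card// proper_card//.
  apply/properP; split=> //; exists j'; rewrite inE//.
  by rewrite nextkj' th_eq opprB addrC subrK ltxx.
Qed.

End Step.

Lemma margins_reach_inv bk : margins_reach pi b bk -> margins_inv bk.
Proof.
elim=> [|bk1 bk2 _ inv [k [k' [j [j' [h1 h2 h3 h4]]]]]].
  exact: margins_init_inv.
have -> : bk2 = margins_next bk1 k k' j j' by apply/funext => m; rewrite h4.
exact: margins_next_inv.
Qed.

Definition negatives bk : {set 'I_N * 'I_n} := [set x | bk x.1 x.2 0 < 0]%SET.

(* Working on a fixed negative entry, each step that does not clear it removes a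
   positive entry of its column or an excess entry of its row. *)
Lemma margins_clear_entry d bk k j : margins_inv bk -> bk k j 0 < 0 ->
  (#|[set m | (0 < bk m j 0)%R]%SET| +
   #|[set x | (csum (pi k) x 0 < bk k x 0)%R]%SET| <= d)%N ->
  margins_reach pi b bk ->
  exists2 bk', margins_reach pi b bk' & negatives bk' \proper negatives bk.
Proof.
elim: d bk => [|d IH] bk inv bkj.
  have [i1 _ _] := inv; move=> le0 _.
  (* The base case is vacuous: column [j] sums to [b j 0 > 0], so it has a positive entry. *)
  suff [m bm] : exists m, 0 < bk m j 0.
    move: le0; rewrite leqn0 addn_eq0 => /andP[/eqP/cards0_eq + _].
    by move=> /setP/(_ m); rewrite !inE bm.
  apply/existsP; apply: contraPT (b0 j); rewrite negb_exists => /forallP h.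
  by apply/negP; rewrite -i1 -leNgt sumr_le0// => m _; rewrite leNgt.
move=> led rbk; have [i1 i2 _] := inv.
have [k' bk'j] : exists k', 0 < bk k' j 0.
  apply/existsP; apply: contraPT (b0 j); rewrite negb_exists => /forallP h.
  by apply/negP; rewrite -i1 -leNgt sumr_le0// => m _; rewrite leNgt.
(* Row [k] keeps the mass of [csum (pi k)], so its deficit at [j] is matched by an excess
   elsewhere. *)
have [j' bkj'] : exists j', csum (pi k) j' 0 < bk k j' 0.
  apply/existsP; apply: contraPT (i2 k); rewrite negb_exists => /forallP h.
  apply/eqP; rewrite lt_eqF// (bigD1 j)//= [ltRHS](bigD1 j)//= ltr_leD//.
    exact: lt_le_trans (csum0 _ _).
  by apply: ler_sum => x _; rewrite leNgt.
set bk1 := margins_next bk k k' j j'.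
have inv1 : margins_inv bk1 by exact: margins_next_inv.
have r1 : margins_reach pi b bk1.
  by apply: margins_reach_step rbk _; exact: margins_step_next.
have sub1 : negatives bk1 \subset negatives bk.
  by apply/fintype.subsetP => -[m x]; rewrite !inE; exact: margins_next_neg.
have [b1|b1] := ltP (bk1 k j 0) 0; last first.
  exists bk1 => //; apply/properP; split=> //; exists (k, j); rewrite inE//=.
  by rewrite -leNgt.
have [|bk2 r2 p2] := IH bk1 inv1 b1 _ r1.
  by rewrite -ltnS (leq_trans _ led)//; exact: margins_next_measure.
by exists bk2 => //; exact: proper_sub_trans p2 sub1.
Qed.

(** Induction on the number of negative entries, cleared one at a time. *)
Lemma margins_exist : exists2 bk, margins_reach pi b bk & forall k j, 0 <= bk k j 0.
Proof.
suff H d bk : (#|negatives bk| <= d)%N -> margins_reach pi b bk ->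
    exists2 bk, margins_reach pi b bk & forall k j, 0 <= bk k j 0.
  exact: (H _ _ (leqnn _) (margins_reach_init _ _)).
elim: d bk => [|d IH] bk led rbk.
  exists bk => // k j; rewrite leNgt.
  move: led; rewrite leqn0 => /eqP/cards0_eq/setP/(_ (k, j)).
  by rewrite !inE => ->.
have [/existsP[[k j] /= bkj]|] := boolP [exists x, bk x.1 x.2 0 < 0].
  have [bk' r' p'] := margins_clear_entry (margins_reach_inv rbk) bkj (leqnn _) rbk.
  by apply: (IH bk') => //; rewrite -ltnS (leq_trans (proper_card p')).
rewrite negb_exists => /forallP h; exists bk => // k j.
by rewrite leNgt; exact: (h (k, j)).
Qed.

(** Within a column all deviations share a sign, so the triangle inequality is an equality. This
    keeps a factor [N] out of the rounding error. *)
Lemma margins_inv_dist bk j : margins_inv bk ->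
  \sum_k `|bk k j 0 - csum (pi k) j 0| = `|b j 0 - csum (\sum_k pi k) j 0|.
Proof.
move=> [i1 _ /(_ j) i3]; rewrite -i1 -sum_csum -sumrB.
case: i3 => h.
  rewrite [RHS]ger0_norm ?sumr_ge0// => [|k _]; last by rewrite subr_ge0.
  by apply: eq_bigr => k _; rewrite ger0_norm// subr_ge0.
rewrite [RHS]ler0_norm ?sumr_le0// => [|k _]; last by rewrite subr_le0.
by rewrite -sumrN; apply: eq_bigr => k _; rewrite ler0_norm// subr_le0.
Qed.

End Margins.

(** * The dual function: Gibbs weights, gradient, concavity, smoothness *)

Section DualFunction.
Set Implicit Arguments.
Unset Strict Implicit.
Variables (R : realType) (n N : nat) (C : 'I_N -> 'M[R]_n) (eps : R).
Hypotheses (n0 : (0 < n)%N) (N0 : (0 < N)%N) (c0 : 0 < cinf C) (e0 : 0 < eps).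
Implicit Types (a b f g : 'cV[R]_n) (l : 'cV[R]_N).

Local Notation eta := (eta_ C eps).
Local Notation c := (cinf C).
Local Notation zeta := (zeta C eps).
Local Notation mass := (zeta_mass C eps).
Local Notation plan := (plan C eps).
Local Notation rz f g l := (rsum (\sum_k zeta f g l k)).
Local Notation cz f g l := (csum (\sum_k zeta f g l k)).
Local Notation cost f g l k := (inner (zeta f g l k) (C k)).

Lemma le_cinf k i j : `|C k i j| <= c.
Proof.
apply: le_trans (le_bigmax _ _ k); apply: le_trans (le_bigmax _ _ i).
exact: le_bigmax.
Qed.

Lemma ln_size_ge0 : 0 <= ln (n ^ 2 * N)%:R :> R.
Proof. by apply: ln_ge0; rewrite ler1n muln_gt0 expn_gt0 n0. Qed.

Lemma eta_gt0 : 0 < eta.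
Proof.
rewrite lt_min c0 andbT divr_gt0// mulr_gt0// ltr_wpDl// ln_size_ge0//.
Qed.

Lemma eta_le_cinf : eta <= c.
Proof. by rewrite ge_min lexx orbT. Qed.

(** The first term of the minimum defining [eta_] is tuned for this: the entropy costs at most
    [eps / 3]. *)
Lemma eta_ln_size_le : eta * ln (n ^ 2 * N)%:R <= eps / 3.
Proof.
have L0 := ln_size_ge0; set L := ln _ in L0 *.
have L1 : 0 < L + 1 by lra.
have : eta <= eps / (3 * (L + 1)) by rewrite ge_min lexx.
rewrite ler_pdivlMr ?mulr_gt0// => h.
have := eta_gt0; nra.
Qed.

(** Logarithm of a Gibbs weight. It is linear in [(f, g, l)], so an increment of the exponent is
    [expo] of the increments. *)
Definition expo f g l (x : 'I_N * ('I_n * 'I_n)) : R :=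
  (f x.2.1 0 + g x.2.2 0 - l x.1 0 * C x.1 x.2.1 x.2.2) / eta.

Lemma zetaE f g l k i j : zeta f g l k i j = expR (expo f g l (k, (i, j))).
Proof. by rewrite mxE. Qed.

Lemma massE f g l : mass f g l = \sum_x expR (expo f g l x).
Proof.
rewrite /zeta_mass -(sum_triple (fun k i j => expR (expo f g l (k, (i, j))))).
apply: eq_bigr => k _; apply: eq_bigr => i _; apply: eq_bigr => j _.
by rewrite mxE ger0_norm ?expR_ge0.
Qed.

Lemma rzE f g l i : rz f g l i 0 = \sum_k \sum_j expR (expo f g l (k, (i, j))).
Proof.
rewrite rsum_sumE.
by apply: eq_bigr => k _; apply: eq_bigr => j _; rewrite mxE.
Qed.

Lemma czE f g l j : cz f g l j 0 = \sum_k \sum_i expR (expo f g l (k, (i, j))).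
Proof.
rewrite csum_sumE.
by apply: eq_bigr => k _; apply: eq_bigr => i _; rewrite mxE.
Qed.

Lemma rz_gt0 f g l i : 0 < rz f g l i 0.
Proof.
by rewrite rzE; do 2![apply: sumr_ord_gt0 => // ?]; exact: expR_gt0.
Qed.

Lemma cz_gt0 f g l j : 0 < cz f g l j 0.
Proof.
by rewrite czE; do 2![apply: sumr_ord_gt0 => // ?]; exact: expR_gt0.
Qed.

Lemma sum_rz f g l : \sum_i rz f g l i 0 = mass f g l.
Proof.
under eq_bigr do rewrite rzE; rewrite exchange_big massE.
exact: (sum_triple (fun k i j => expR (expo f g l (k, (i, j))))).
Qed.

Lemma sum_cz f g l : \sum_j cz f g l j 0 = mass f g l.
Proof.
under eq_bigr do rewrite czE; rewrite exchange_big massE.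
rewrite -(sum_triple (fun k i j => expR (expo f g l (k, (i, j))))).
by apply: eq_bigr => k _; rewrite exchange_big.
Qed.

Lemma mass_gt0 f g l : 0 < mass f g l.
Proof. by rewrite -sum_rz sumr_ord_gt0// => i; exact: rz_gt0. Qed.

Lemma plan_unit_mass f g l : mass f g l = 1 -> plan f g l = zeta f g l.
Proof. by move=> m1; apply/funext => k; rewrite /plan m1 invr1 scale1r. Qed.

(** The directional derivative of the mass, expressed through marginals and costs. *)
Lemma sum_expo_mul f g l (df dg : 'cV[R]_n) (dl : 'cV[R]_N) :
  \sum_x expR (expo f g l x) * expo df dg dl x =
  (inner df (rz f g l) + inner dg (cz f g l)
    - \sum_k dl k 0 * cost f g l k) / eta.
Proof.
rewrite -(sum_triple (fun k i j => expR (expo f g l (k, (i, j))) *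
  expo df dg dl (k, (i, j)))).
rewrite !inner_vecE.
have -> : \sum_i df i 0 * rz f g l i 0 =
    \sum_k \sum_i \sum_j expR (expo f g l (k, (i, j))) * df i 0.
  rewrite exchange_big; apply: eq_bigr => i _; rewrite rzE mulr_sumr.
  apply: eq_bigr => k _; rewrite mulr_sumr.
  by apply: eq_bigr => j _; rewrite mulrC.
have -> : \sum_j dg j 0 * cz f g l j 0 =
    \sum_k \sum_i \sum_j expR (expo f g l (k, (i, j))) * dg j 0.
  under [RHS]eq_bigr do rewrite exchange_big.
  rewrite exchange_big; apply: eq_bigr => j _; rewrite czE mulr_sumr.
  apply: eq_bigr => k _; rewrite mulr_sumr.
  by apply: eq_bigr => i _; rewrite mulrC.
rewrite -big_split -sumrB mulr_suml /=; apply: eq_bigr => k _.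
rewrite -big_split mulr_sumr -sumrB mulr_suml /=; apply: eq_bigr => i _.
rewrite -big_split mulr_sumr -sumrB mulr_suml /=; apply: eq_bigr => j _.
by rewrite mxE -[X in expR X]/(expo f g l (k, (i, j))) /expo /=; ring.
Qed.

Lemma mass_shift f g l (df dg : 'cV[R]_n) (dl : 'cV[R]_N) :
  mass (f + df) (g + dg) (l + dl) =
  \sum_x expR (expo f g l x) * expR (expo df dg dl x).
Proof.
rewrite massE; apply: eq_bigr => x _; rewrite -expRD /expo !mxE.
by congr expR; ring.
Qed.

(** The derivative of log-sum-exp is a Gibbs mean, here of [- C k / eta] on block [k]; the factor
    [- eta] of [dualF] cancels. *)
Lemma grad_lE a b f g l k :
  grad_l a b C eps f g l k 0 = inner (plan f g l k) (C k).
Proof.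
have e0' : eta != 0 by rewrite gt_eqF ?eta_gt0.
rewrite mxE.
pose h := fun s : R => \sum_x expR (expo f g l x) *
  expR (expo 0 0 (s *: delta_mx k 0) x).
pose A := inner f a + inner g b - eta.
have -> : (fun s : R => dualF a b C eps f g (l + s *: delta_mx k 0)) =
    cst A - (eta \*: (@ln R \o h)).
  apply/funext => s /=; rewrite /dualF -[f in mass f]addr0 -[g in mass _ g]addr0.
  rewrite mass_shift !fctE /= -/(h s) /A.
  by rewrite -[_ *: _]/(eta * ln (h s)); ring.
have Ex x s : expo 0 0 (s *: delta_mx k 0) x =
    - (s * ((x.1 == k)%:R * C x.1 x.2.1 x.2.2 / eta)).
  by rewrite /expo !mxE eqxx andbT; ring.
have h0 : h 0 = mass f g l.
  rewrite massE /h; apply: eq_bigr => x _.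
  by rewrite Ex mul0r oppr0 expR0 mulr1.
have hd : is_derive (0 : R) 1 h
    (- \sum_x expR (expo f g l x) * ((x.1 == k)%:R * C x.1 x.2.1 x.2.2 / eta)).
  rewrite -sumrN; apply: is_derive_bigsum => x.
  set w := _ / eta.
  have -> : (fun s : R => expR (expo f g l x) * expR (expo 0 0 (s *: delta_mx k 0) x)) =
      expR (expo f g l x) \*: (expR \o ((- w) \*: id)).
    apply/funext => s /=; rewrite Ex /GRing.scale /= -/w.
    by rewrite mulNr [s * w]mulrC.
  apply: is_derive_eq.
  rewrite /= -[(- w) *: 0]/(- w * 0) mulr0 expR0 /GRing.scale /=.
  by rewrite mul1r mulr1 mulrN.
have costE : \sum_x expR (expo f g l x) *
    ((x.1 == k)%:R * C x.1 x.2.1 x.2.2 / eta) = cost f g l k / eta.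
  rewrite /inner -(sum_triple (fun k' i j => expR (expo f g l (k', (i, j))) *
    ((k' == k)%:R * C k' i j / eta))).
  rewrite (bigD1 k)//= [X in _ + X]big1 ?addr0; last first.
    move=> k' /negbTE kk; apply: big1 => i _; apply: big1 => j _.
    by rewrite kk !mul0r mulr0.
  rewrite mulr_suml; apply: eq_bigr => i _; rewrite mulr_suml.
  by apply: eq_bigr => j _; rewrite eqxx mxE mul1r mulrA.
rewrite costE in hd.
have m0 : 0 < h 0 by rewrite h0 mass_gt0.
have ld := is_derive1_ln m0.
rewrite derive1E.
have -> : 'D_1 (cst A - eta \*: (@ln R \o h)) 0 = (mass f g l)^-1 * cost f g l k.
  apply: derive_val; apply: is_derive_eq.
  rewrite h0 /GRing.scale /= sub0r; field.
  by rewrite e0' gt_eqF ?mass_gt0.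
rewrite /inner mulr_sumr; apply: eq_bigr => i _; rewrite mulr_sumr.
by apply: eq_bigr => j _; rewrite [plan _ _ _ _ _ _]mxE mulrA.
Qed.


Lemma sum_subE l l' (w : 'I_N -> R) :
  \sum_k (l' - l) k 0 * w k = \sum_k (l' k 0 - l k 0) * w k.
Proof. by apply: eq_bigr => k _; rewrite !mxE. Qed.

(** Concavity: Jensen's inequality for the Gibbs law puts [dualF] below its tangent plane, whose
    slopes at unit mass are the marginal residuals and the costs. *)
Lemma dualF_diff_le a b f g l f' g' l' : mass f g l = 1 ->
  dualF a b C eps f' g' l' - dualF a b C eps f g l <=
  inner (f' - f) (a - rz f g l) + inner (g' - g) (b - cz f g l)
  + \sum_k (l' k 0 - l k 0) * cost f g l k.
Proof.
move=> m1.
have p1 : \sum_x expR (expo f g l x) = 1 by rewrite -massE.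
have := mean_le_ln_mean_exp (expo (f' - f) (g' - g) (l' - l))
  (fun x => expR_ge0 (expo f g l x)) p1.
rewrite sum_expo_mul -mass_shift ![_ + (_ - _)]addrC !subrK.
rewrite ler_pdivrMr ?eta_gt0// /dualF m1 ln1 mulr0 subr0 !innerBl !innerBr.
rewrite sum_subE.
by lra.
Qed.

(** Smoothness in [l]: Hoeffding's lemma for the exponent increments, bounded by [c * y / eta] since
    each entry of [l' - l] is at most its Euclidean norm. *)
Lemma dualF_l_ge a b f g l l' : mass f g l = 1 ->
  \sum_k (l' k 0 - l k 0) * cost f g l k - c ^+ 2 / (2 * eta) * norm2 (l' - l) ^+ 2
  <= dualF a b C eps f g l' - dualF a b C eps f g l.
Proof.
move=> m1; set y := norm2 _.
have p1 : \sum_x expR (expo f g l x) = 1 by rewrite -massE.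
have dM x : `|expo 0 0 (l' - l) x| <= c * y / eta.
  rewrite /expo !mxE !add0r normrM normfV (gtr0_norm eta_gt0).
  rewrite ler_pM2r ?invr_gt0 ?eta_gt0// normrN normrM mulrC.
  have := entry_le_norm2 (l' - l) x.1; rewrite !mxE => h.
  by rewrite ler_pM ?le_cinf.
have := hoeffding (fun x => expR_ge0 (expo f g l x)) p1 dM.
rewrite sum_expo_mul -mass_shift !addr0 [l + _]addrC subrK !inner0l !add0r.
rewrite sum_subE.
set s := \sum_k _; have := eta_gt0 => eta0.
have -> : - s / eta + (c * y / eta) ^+ 2 / 2 =
    (c ^+ 2 / (2 * eta) * y ^+ 2 - s) / eta.
  by field; rewrite gt_eqF.
by rewrite ler_pdivlMr// /dualF m1 ln1; lra.
Qed.

Lemma relative_entropy_ge0 m (a r : 'cV[R]_m) :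
  (forall i, 0 < a i 0) -> \sum_i a i 0 = 1 -> (forall i, 0 < r i 0) ->
  0 <= \sum_i a i 0 * ln (a i 0 / r i 0) + ln (\sum_i r i 0).
Proof.
move=> a0 a1 r0; set s := \sum_i r i 0.
have s0 : 0 < s.
  have : s != 0.
    rewrite psumr_eq0 => [|i _]; last exact: ltW.
    apply/negP => /allP h; move: a1; rewrite big1 => [/eqP|i _].
      by rewrite eq_sym oner_eq0.
    by have := h i (mem_index_enum _); rewrite gt_eqF.
  by rewrite lt_def => ->; rewrite sumr_ge0// => i _; exact: ltW.
have q0 i : 0 < r i 0 / s by rewrite divr_gt0.
have q1 : \sum_i r i 0 / s = 1 by rewrite -mulr_suml divff ?gt_eqF.
have := gibbs (fun i => ltW (a0 i)) q0 a1 q1; rewrite -subr_ge0 -sumrB.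
have -> : \sum_i (a i 0 * ln (a i 0) - a i 0 * ln (r i 0 / s)) =
    \sum_i (a i 0 * ln (a i 0 / r i 0) + a i 0 * ln s).
  by apply: eq_bigr => i _; rewrite !ln_div ?posrE//; ring.
by rewrite big_split /= -mulr_suml a1 mul1r.
Qed.

(** * Exact marginals and ascent after the two potential updates *)

Section Updates.
Variables (a b : 'cV[R]_n).
Hypotheses (sa : simplex a) (a0 : forall i, 0 < a i 0).
Hypotheses (sb : simplex b) (b0 : forall i, 0 < b i 0).

Lemma expR_expo_upd_f f g l k i j :
  expR (expo (upd_f a C eps f g l) g l (k, (i, j))) =
  expR (expo f g l (k, (i, j))) * (a i 0 / rz f g l i 0).
Proof.
have r0 : 0 < a i 0 / rz f g l i 0 by rewrite divr_gt0 ?rz_gt0.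
rewrite -[in RHS](lnK r0) -expRD; congr expR; rewrite /expo /= mxE.
by field; rewrite gt_eqF ?eta_gt0.
Qed.

Lemma expR_expo_upd_g f g l k i j :
  expR (expo f (upd_g b C eps f g l) l (k, (i, j))) =
  expR (expo f g l (k, (i, j))) * (b j 0 / cz f g l j 0).
Proof.
have r0 : 0 < b j 0 / cz f g l j 0 by rewrite divr_gt0 ?cz_gt0.
rewrite -[in RHS](lnK r0) -expRD; congr expR; rewrite /expo /= mxE.
by field; rewrite gt_eqF ?eta_gt0.
Qed.

Lemma rz_upd_f f g l : rz (upd_f a C eps f g l) g l = a.
Proof.
apply/matrixP => i i'; rewrite ord1 rzE.
under eq_bigr do under eq_bigr do rewrite expR_expo_upd_f.
under eq_bigr do rewrite -mulr_suml.
by rewrite -mulr_suml -rzE mulrC divfK ?gt_eqF ?rz_gt0.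
Qed.

Lemma cz_upd_g f g l : cz f (upd_g b C eps f g l) l = b.
Proof.
apply/matrixP => j j'; rewrite ord1 czE.
under eq_bigr do under eq_bigr do rewrite expR_expo_upd_g.
under eq_bigr do rewrite -mulr_suml.
by rewrite -mulr_suml -czE mulrC divfK ?gt_eqF ?cz_gt0.
Qed.

(** So the logarithm in [dualF] vanishes after the update, and [plan] coincides with [zeta]. *)
Lemma mass_upd_f f g l : mass (upd_f a C eps f g l) g l = 1.
Proof. by rewrite -sum_rz rz_upd_f; case: sa. Qed.

Lemma mass_upd_g f g l : mass f (upd_g b C eps f g l) l = 1.
Proof. by rewrite -sum_cz cz_upd_g; case: sb. Qed.

Lemma dualF_upd_f f g l :
  dualF a b C eps f g l <= dualF a b C eps (upd_f a C eps f g l) g l.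
Proof.
rewrite /dualF mass_upd_f ln1.
have -> : inner (upd_f a C eps f g l) a =
    inner f a + eta * \sum_i a i 0 * ln (a i 0 / rz f g l i 0).
  rewrite !inner_vecE mulr_sumr -big_split; apply: eq_bigr => i _.
  by rewrite mxE /=; ring.
have := @relative_entropy_ge0 _ a (rz f g l) a0 sa.2 (rz_gt0 f g l).
rewrite sum_rz => /(mulr_ge0 (ltW eta_gt0)); lra.
Qed.

Lemma dualF_upd_gE f g l :
  dualF a b C eps f (upd_g b C eps f g l) l - dualF a b C eps f g l =
  eta * (\sum_j b j 0 * ln (b j 0 / cz f g l j 0) + ln (mass f g l)).
Proof.
rewrite /dualF mass_upd_g ln1.
have -> : inner (upd_g b C eps f g l) b =
    inner g b + eta * \sum_i b i 0 * ln (b i 0 / cz f g l i 0).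
  rewrite !inner_vecE mulr_sumr -big_split; apply: eq_bigr => i _.
  by rewrite mxE /=; ring.
by ring.
Qed.

Lemma dualF_upd_g f g l :
  dualF a b C eps f g l <= dualF a b C eps f (upd_g b C eps f g l) l.
Proof.
rewrite -subr_ge0 dualF_upd_gE -(sum_cz f g l) mulr_ge0 ?(ltW eta_gt0)//.
exact: (relative_entropy_ge0 b0 sb.2 (cz_gt0 f g l)).
Qed.

Lemma dualF_upd_g_ge f g l : mass f g l = 1 ->
  eta / 2 * norm1 (cz f g l - b) ^+ 2 <=
  dualF a b C eps f (upd_g b C eps f g l) l - dualF a b C eps f g l.
Proof.
move=> m1; rewrite dualF_upd_gE m1 ln1 addr0 mulrAC -mulrA.
rewrite ler_pM2l ?eta_gt0//.
have c1 : \sum_j cz f g l j 0 = 1 by rewrite sum_cz.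
have := pinsker b0 (cz_gt0 f g l) sb.2 c1.
rewrite norm1_vecE; congr (_ ^+ 2 / _ <= _).
by apply: eq_bigr => j _; rewrite !mxE distrC.
Qed.

(** The old [g] cancels: the new entry is [eta * (ln (b j 0) - ln (K j))]. Costs in two columns
    differ by at most [2 * c], so [ln K] varies by at most [2 * c / eta], and [ln b] lies between
    [iota_min b] and 0. *)
Lemma upd_g_osc f g l i j : simplex l ->
  upd_g b C eps f g l i 0 - upd_g b C eps f g l j 0 <= 2 * c - eta * iota_min b.
Proof.
move=> sl.
pose K j := \sum_k \sum_i expR ((f i 0 - l k 0 * C k i j) / eta).
have K0 j' : 0 < K j' by do 2![apply: sumr_ord_gt0 => // ?]; exact: expR_gt0.
have czK j' : cz f g l j' 0 = expR (g j' 0 / eta) * K j'.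
  rewrite czE mulr_sumr; apply: eq_bigr => k _; rewrite mulr_sumr.
  by apply: eq_bigr => i' _; rewrite -expRD; congr expR; rewrite /expo /=; ring.
have updK j' : upd_g b C eps f g l j' 0 = eta * (ln (b j' 0) - ln (K j')).
  rewrite mxE czK ln_div ?lnM ?posrE ?mulr_gt0 ?expR_gt0// expRK.
  by field; rewrite gt_eqF ?eta_gt0.
have KK : ln (K j) - ln (K i) <= 2 * c / eta.
  rewrite -ler_expR expRB !lnK ?posrE// ler_pdivrMr// mulr_sumr.
  apply: ler_sum => k _; rewrite mulr_sumr; apply: ler_sum => i' _.
  rewrite -expRD ler_expR -mulrDl ler_pM2r ?invr_gt0 ?eta_gt0//.
  have /andP[l0 l1] := simplex_le1 k sl.
  have := le_cinf k i' j; have := le_cinf k i' i; rewrite !ler_norml.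
  move=> /andP[? ?] /andP[? ?].
  have : l k 0 * (C k i' i - C k i' j) <= 2 * c.
    have h : C k i' i - C k i' j <= 2 * c by lra.
    by rewrite (le_trans (ler_wpM2l l0 h))// ler_piMl// mulr_ge0// ltW.
  by lra.
have bi : ln (b i 0) <= 0.
  by rewrite ln_le0//; have /andP[] := simplex_le1 i sb.
have bj : iota_min b <= ln (b j 0) by exact: bigmin_le.
rewrite !updK -mulrBr.
have : eta * (ln (K j) - ln (K i)) <= 2 * c.
  by rewrite mulrC -ler_pdivlMr ?eta_gt0.
have := mulr_ge0_le0 (ltW eta_gt0) bi.
have := ler_wpM2l (ltW eta_gt0) bj.
by lra.
Qed.

Lemma cost_abs_sum_le f g l : \sum_k `|cost f g l k| <= c * mass f g l.
Proof.
rewrite /zeta_mass mulr_sumr; apply: ler_sum => k _.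
rewrite /inner /norm1 mulr_sumr (le_trans (ler_norm_sum _ _ _))//.
apply: ler_sum => i _; rewrite mulr_sumr (le_trans (ler_norm_sum _ _ _))//.
by apply: ler_sum => j _; rewrite normrM mulrC ler_wpM2r ?le_cinf.
Qed.

(** The update multiplies column [j] by [b j 0 / cz f g l j 0], so the weights move by exactly the
    column residual in the l1 norm. *)
Lemma cost_upd_g_diff f g l (d : 'I_N -> R) : (forall k, `|d k| <= 1) ->
  \sum_k d k * cost f g l k - \sum_k d k * cost f (upd_g b C eps f g l) l k <=
  c * norm1 (cz f g l - b).
Proof.
move=> d1; rewrite norm1_vecE mulr_sumr.
have -> : \sum_j c * `|(cz f g l - b) j 0| =
    \sum_k \sum_i \sum_j c * (expR (expo f g l (k, (i, j))) * `|1 - b j 0 / cz f g l j 0|).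
  under [RHS]eq_bigr do rewrite exchange_big.
  rewrite exchange_big; apply: eq_bigr => j _ /=.
  under [RHS]eq_bigr do rewrite -mulr_sumr -mulr_suml.
  rewrite -mulr_sumr -mulr_suml -czE; congr (_ * _).
  rewrite -{1}(gtr0_norm (cz_gt0 f g l j)) -normrM mulrBr mulr1 mulrCA divff.
    by rewrite mulr1 !mxE.
  by rewrite gt_eqF ?cz_gt0.
rewrite -sumrB; apply: ler_sum => k _; rewrite -mulrBr /inner -sumrB mulr_sumr.
apply: ler_sum => i _; rewrite -sumrB mulr_sumr; apply: ler_sum => j _.
rewrite !zetaE expR_expo_upd_g.
set e := expR _; set r := _ / _.
have -> : d k * (e * C k i j - e * r * C k i j) = d k * (C k i j * (e * (1 - r))).
  by ring.
rewrite (le_trans (ler_norm _))// !normrM (gtr0_norm (expR_gt0 _)).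
have e1 : 0 <= e * `|1 - r| by rewrite mulr_ge0 ?expR_ge0.
rewrite -[leRHS]mul1r ler_pM// ?mulr_ge0//.
by rewrite ler_wpM2r ?le_cinf.
Qed.

(** * The projected gradient step in [l] *)

Section LambdaStep.
Variables (f g : 'cV[R]_n) (l : 'cV[R]_N).
Hypotheses (m1 : mass f g l = 1) (sl : simplex l).

Let l1 := upd_l a b C eps f g l.
Let y := norm2 (l1 - l).

Lemma upd_l_variational q : simplex q ->
  eta / c ^+ 2 * \sum_k (q k 0 - l1 k 0) * cost f g l k <=
  \sum_k (l1 k 0 - l k 0) * (q k 0 - l1 k 0).
Proof.
move=> sq.
have [_ /(_ q sq) h] := @proj_simplexP _ _ (l + tau_ C eps *: grad_l a b C eps f g l) N0.
rewrite -subr_le0 mulr_sumr -sumrB; move: h; rewrite -/l1; congr (_ <= _).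
apply: eq_bigr => k _; rewrite -[proj_simplex _]/l1.
have -> : (l + tau_ C eps *: grad_l a b C eps f g l) k 0 =
    l k 0 + tau_ C eps * cost f g l k.
  by rewrite mxE; congr (_ + _); rewrite mxE grad_lE (plan_unit_mass m1).
by rewrite /tau_; ring.
Qed.

Lemma simplex_upd_l : simplex l1.
Proof. by have [] := @proj_simplexP _ _ (l + tau_ C eps *: grad_l a b C eps f g l) N0. Qed.

(** Testing the projection inequality at [q = l] gives a first-order gain of at least
    [c ^+ 2 / eta * y ^+ 2]; smoothness costs half of it. *)
Lemma dualF_upd_l_ge :
  c ^+ 2 / (2 * eta) * y ^+ 2 <= dualF a b C eps f g l1 - dualF a b C eps f g l.
Proof.
have eta0 := eta_gt0.
apply: le_trans (dualF_l_ge a b l1 m1); rewrite -/y.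
have := upd_l_variational sl.
have -> : \sum_k (l1 k 0 - l k 0) * (l k 0 - l1 k 0) = - y ^+ 2.
  by rewrite /y sqr_norm2 -sumrN; apply: eq_bigr => k _; rewrite !mxE; ring.
have -> : \sum_k (l k 0 - l1 k 0) * cost f g l k = - \sum_k (l1 k 0 - l k 0) * cost f g l k.
  by rewrite -sumrN; apply: eq_bigr => k _; ring.
set s := \sum_k _; rewrite mulrN lerN2 => h.
have : c ^+ 2 / eta * y ^+ 2 <= s.
  have -> : s = c ^+ 2 / eta * (eta / c ^+ 2 * s).
    by field; rewrite !gt_eqF.
  by rewrite ler_wpM2l// divr_ge0 ?sqr_ge0// ltW.
have -> : c ^+ 2 / (2 * eta) * y ^+ 2 = (c ^+ 2 / eta * y ^+ 2) / 2.
  by field; rewrite gt_eqF.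
by lra.
Qed.

(** Split at [l1]. From [l1] to [q] the projection inequality and the l1 diameter 2 of the simplex
    give the factor 2; from [l] to [l1] the costs sum to at most [c], and [c <= c ^+ 2 / eta]
    because [eta <= c]. *)
Lemma grad_l_ascent_le q : simplex q ->
  \sum_k (q k 0 - l k 0) * cost f g l k <= 3 * c ^+ 2 / eta * y.
Proof.
move=> sq; have eta0 := eta_gt0; have y0 : 0 <= y by exact: norm2_ge0.
have ly k : `|l1 k 0 - l k 0| <= y.
  by have := entry_le_norm2 (l1 - l) k; rewrite !mxE.
have h1 : \sum_k (q k 0 - l1 k 0) * cost f g l k <= 2 * c ^+ 2 / eta * y.
  set s := \sum_k _.
  have -> : s = c ^+ 2 / eta * (eta / c ^+ 2 * s).
    by field; rewrite !gt_eqF.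
  have -> : 2 * c ^+ 2 / eta * y = c ^+ 2 / eta * (y * 2) by ring.
  rewrite ler_wpM2l ?divr_ge0 ?sqr_ge0 ?(ltW eta0)//.
  apply: le_trans (upd_l_variational sq) _.
  apply: le_trans (ler_wpM2l y0 (simplex_sum_dist_le2 sq simplex_upd_l)).
  rewrite mulr_sumr; apply: ler_sum => k _.
  by rewrite (le_trans (ler_norm _))// normrM ler_wpM2r.
have h2 : \sum_k (l1 k 0 - l k 0) * cost f g l k <= c ^+ 2 / eta * y.
  apply: (@le_trans _ _ (y * \sum_k `|cost f g l k|)).
    rewrite mulr_sumr; apply: ler_sum => k _.
    by rewrite (le_trans (ler_norm _))// normrM ler_wpM2r.
  rewrite mulrC ler_wpM2r// (le_trans (cost_abs_sum_le f g l))// m1 mulr1.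
  by rewrite ler_pdivlMr// expr2 ler_wpM2l ?eta_le_cinf// ltW.
have -> : \sum_k (q k 0 - l k 0) * cost f g l k =
  \sum_k (q k 0 - l1 k 0) * cost f g l k + \sum_k (l1 k 0 - l k 0) * cost f g l k.
  by rewrite -big_split; apply: eq_bigr => k _ /=; ring.
have -> : 3 * c ^+ 2 / eta * y = 2 * c ^+ 2 / eta * y + c ^+ 2 / eta * y by ring.
exact: lerD.
Qed.

End LambdaStep.

(** * The iterates, their dual gap and the iteration count *)

Local Notation ft := (pam_f a b C eps).
Local Notation gt := (pam_g a b C eps).
Local Notation lt := (pam_l a b C eps).
Local Notation osc := (2 * c - eta * iota_min b).

Lemma pam_fS t : ft t.+1 = upd_f a C eps (ft t) (gt t) (lt t).
Proof. by rewrite /pam_f /pam_g /pam_l /=; case: pam => [[]]. Qed.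

Lemma pam_gS t : gt t.+1 = upd_g b C eps (ft t.+1) (gt t) (lt t).
Proof. by rewrite /pam_f /pam_g /pam_l /=; case: pam => [[]]. Qed.

Lemma pam_lS t : lt t.+1 = upd_l a b C eps (ft t.+1) (gt t.+1) (lt t).
Proof. by rewrite /pam_f /pam_g /pam_l /=; case: pam => [[]]. Qed.

Lemma simplex_pam_l t : simplex (lt t).
Proof.
case: t => [|t]; last by rewrite pam_lS; exact: simplex_upd_l.
have N1 : N%:R != 0 :> R by rewrite pnatr_eq0 -lt0n.
split=> [i|]; first by rewrite mxE invr_ge0.
under eq_bigr do rewrite mxE.
by rewrite sumr_const card_ord -[RHS](mulVf N1) mulr_natr.
Qed.

Lemma iota_min_le0 : iota_min b <= 0.
Proof. exact: bigmin_le_id. Qed.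

Lemma osc_ge : 2 * c <= osc.
Proof.
by have := mulr_ge0_le0 (ltW eta_gt0) iota_min_le0; lra.
Qed.

Lemma pam_g_osc t i j : gt t i 0 - gt t j 0 <= osc.
Proof.
case: t => [|t]; last by rewrite pam_gS upd_g_osc//; exact: simplex_pam_l.
rewrite !mxE subrr; have := osc_ge; have := c0; lra.
Qed.

Lemma mass_half t : mass (ft t.+1) (gt t) (lt t) = 1.
Proof. by rewrite pam_fS mass_upd_f. Qed.

Lemma rz_half t : rz (ft t.+1) (gt t) (lt t) = a.
Proof. by rewrite pam_fS rz_upd_f. Qed.

Lemma pam_planE t : pam_plan a b C eps t.+1 = zeta (ft t.+1) (gt t) (lt t).
Proof. by rewrite /pam_plan (plan_unit_mass (mass_half t)). Qed.

(** The gap is followed right after the [f] update, where the stopping condition is tested and the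
    row marginal is exact. *)
Local Notation half t :=
  (dualF a b C eps (pam_f a b C eps t.+1) (pam_g a b C eps t) (pam_l a b C eps t)).
Local Notation xt t := (norm1 (cz (ft t.+1) (gt t) (lt t) - b)).
Local Notation yt t := (norm2 (lt t.+1 - lt t)).

Lemma half_step_increase t :
  eta / 2 * xt t ^+ 2 + c ^+ 2 / (2 * eta) * yt t ^+ 2 <= half t.+1 - half t.
Proof.
have h1 := dualF_upd_g_ge (mass_half t); rewrite -pam_gS in h1.
have h2 : c ^+ 2 / (2 * eta) * yt t ^+ 2 <=
    dualF a b C eps (ft t.+1) (gt t.+1) (lt t.+1) -
    dualF a b C eps (ft t.+1) (gt t.+1) (lt t).
  rewrite [lt t.+1]pam_lS; apply: dualF_upd_l_ge; last exact: simplex_pam_l.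
  by rewrite pam_gS mass_upd_g.
have h3 := dualF_upd_f (ft t.+1) (gt t.+1) (lt t.+1); rewrite -pam_fS in h3.
apply: le_trans (lerD h1 h2) _.
by rewrite addrC addrA subrK lerB.
Qed.

(** The ascent bound holds after the [g] update, where the gradient is taken; moving back to the
    half step costs [c * xt t]. *)
Lemma half_cost_gap_le t q : simplex q ->
  \sum_k (q k 0 - lt t k 0) * cost (ft t.+1) (gt t) (lt t) k <=
  c * xt t + 3 * c ^+ 2 / eta * yt t.
Proof.
move=> sq; have sl := simplex_pam_l t.
have d1 k : `|q k 0 - lt t k 0| <= 1.
  have /andP[? ?] := simplex_le1 k sq; have /andP[? ?] := simplex_le1 k sl.
  by rewrite ler_norml; apply/andP; split; lra.
have := cost_upd_g_diff (ft t.+1) (gt t) (lt t) d1; rewrite -pam_gS.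
have m1 : mass (ft t.+1) (gt t.+1) (lt t) = 1 by rewrite pam_gS mass_upd_g.
have := grad_l_ascent_le m1 sq; rewrite -pam_lS; lra.
Qed.

(* An extra update of [gs] makes its oscillation bounded without decreasing the
   dual function. *)
Lemma half_gap_le t fs gs ls : simplex ls ->
  dualF a b C eps fs gs ls - half t <=
  (osc + c) * xt t + 3 * c ^+ 2 / eta * yt t.
Proof.
move=> sls; pose gs' := upd_g b C eps fs gs ls.
have h1 : dualF a b C eps fs gs ls <= dualF a b C eps fs gs' ls.
  exact: dualF_upd_g.
apply: le_trans (lerB h1 (lexx _)) _.
apply: le_trans (dualF_diff_le a b fs gs' ls (mass_half t)) _.
rewrite rz_half [inner _ (a - a)]innerBr subrr add0r mulrDl -addrA.
apply: lerD; last exact: half_cost_gap_le.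
have -> : xt t = norm1 (b - cz (ft t.+1) (gt t) (lt t)).
  by rewrite !norm1_vecE; apply: eq_bigr => j _; rewrite !mxE distrC.
have -> : osc = (osc + osc) / 2 by field.
apply: inner_centered_le => // [i j|].
  rewrite ![(gs' - gt t) _ _]mxE ![(- gt t) _ _]mxE.
  have := upd_g_osc fs gs i j sls; rewrite -/gs'.
  by have := pam_g_osc t j i; lra.
under eq_bigr do rewrite mxE.
rewrite big_split /= sb.2; under eq_bigr do rewrite mxE.
by rewrite sumrN sum_cz mass_half subrr.
Qed.

(** [r] is the larger of [osc] and [3 * c]. *)
Lemma gamma0_radius : exists2 r, [/\ 0 < r, osc <= r, 3 * c <= r & r <= osc + 4 * c] &
  gamma0 b C eps = (r ^+ 2)^-1.
Proof.
have := osc_ge; have := c0; set U := osc => cc U2.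
have sqE : 9 * c ^+ 2 = (3 * c) ^+ 2 by ring.
rewrite /gamma0 -/U sqE; have [h|/ltW h] := leP U (3 * c).
  exists (3 * c); first by split; lra.
  by apply/min_idPr; rewrite lef_pV2 ?posrE ?exprn_gt0 ?lerXn2r ?nnegrE//; lra.
exists U; first by split; lra.
by apply/min_idPl; rewrite lef_pV2 ?posrE ?exprn_gt0 ?lerXn2r ?nnegrE//; lra.
Qed.

Lemma TboundE r : 0 < r -> gamma0 b C eps = (r ^+ 2)^-1 ->
  Tbound b C eps = 5 + 36 * (r * (osc + 4 * c)) / (eta * eps)
    + 648 * c ^+ 2 / (eta * eps) + 28 * r ^+ 2 / (eta * eps).
Proof.
move=> r0 gr; rewrite /Tbound gr sqrtrV ?sqr_ge0// sqrtr_sqr (gtr0_norm r0) /eps'.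
have v0 : 0 < osc + 4 * c by have := osc_ge; have := c0; lra.
have -> : 6 * c - eta * iota_min b = osc + 4 * c by ring.
have eta0 := eta_gt0; have cn := c0; have en := e0.
by field; rewrite !gt_eqF.
Qed.

Lemma stop_exists fs gs ls : dualF_maximizer a b C eps fs gs ls ->
  exists2 t, pam_stop_cond a b C eps fs gs ls t.+1 & t.+1%:R <= Tbound b C eps.
Proof.
move=> [sls maxF].
have [r [r0 Ur cr rv] gr] := gamma0_radius.
have eta0 := eta_gt0; have cn := c0; have en := e0; have U2 := osc_ge.
rewrite (TboundE r0 gr).
pose v := osc + 4 * c; rewrite -/v.
have v0 : 0 < v by rewrite /v; lra.
have v73 : v <= 7 / 3 * r by rewrite /v; lra.
have c3v : 3 * c <= v by rewrite /v; lra.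
have c3 : 0 < 3 * c by exact: mulr_gt0.
rewrite -/v in rv.
have vE : 6 * c - eta * iota_min b = v by rewrite /v; ring.
clearbody v.
pose u t := dualF a b C eps fs gs ls - half t.
have u0 t : 0 <= u t by rewrite subr_ge0 maxF//; exact: simplex_pam_l.
have inc t : eta / 2 * xt t ^+ 2 + c ^+ 2 / (2 * eta) * yt t ^+ 2 <= u t - u t.+1.
  have E (x y z : R) : x - y - (x - z) = z - y by ring.
  by rewrite /u E half_step_increase.
(* With [z = c * y / eta] the gap is at most [r * (4 / 3 * x + z)], as [osc + c <= 4 / 3 * r]. Its
   square is at most [32 / 9 * r ^+ 2 * (x ^+ 2 + z ^+ 2)], while the decrease is at least
   [eta / 2 * (x ^+ 2 + z ^+ 2)]. *)
pose D := 64 / 9 * r ^+ 2 / eta.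
have D0 : 0 < D by rewrite !divr_gt0 ?mulr_gt0 ?exprn_gt0.
have uD t : u t ^+ 2 <= D * (u t - u t.+1).
  apply: le_trans (ler_wpM2l (ltW D0) (inc t)).
  have x0 : 0 <= xt t by rewrite norm1_vecE sumr_ge0.
  have y0 : 0 <= yt t by exact: norm2_ge0.
  have := half_gap_le t fs gs sls; rewrite -/(u t).
  move: (xt t) (yt t) (u t) (u0 t) x0 y0 => x y w w0 x0 y0 h.
  have cy : 0 <= c * y / eta by rewrite divr_ge0 ?mulr_ge0 ?(ltW cn) ?(ltW eta0).
  have h' : w <= r * (4 / 3 * x + c * y / eta).
    apply: (le_trans h).
    have -> : 3 * c ^+ 2 / eta * y = 3 * c * (c * y / eta) by ring.
    rewrite mulrDr lerD//; last by rewrite ler_wpM2r.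
    by rewrite mulrA ler_wpM2r//; lra.
  apply: (@le_trans _ _ ((r * (4 / 3 * x + c * y / eta)) ^+ 2)).
    by rewrite lerXn2r ?nnegrE// (le_trans w0).
  have -> : D * (eta / 2 * x ^+ 2 + c ^+ 2 / (2 * eta) * y ^+ 2) =
      r ^+ 2 * (32 / 9 * x ^+ 2 + 32 / 9 * (c * y / eta) ^+ 2).
    by rewrite /D; field; rewrite gt_eqF.
  rewrite exprMn ler_wpM2l ?sqr_ge0//.
  have := sqr_ge0 (4 / 3 * x - c * y / eta); have := sqr_ge0 (c * y / eta); nra.
pose ee := eta * eps; have ee0 : 0 < ee by exact: mulr_gt0.
(* The decrease forced by a column residual above [eps / (6 * v)]. An [l] residual above its
   threshold forces the same with [3 * c] for [v], which is no less since [3 * c <= v]. *)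
pose w := eta * eps ^+ 2 / (72 * v ^+ 2).
have w0 : 0 < w by rewrite !(divr_gt0, mulr_gt0, exprn_gt0).
(* Chosen so that [m0 + m1] is the sum of the first and last fractions of [Tbound]. *)
pose m0 := (18 * (r * v) + 28 * r ^+ 2) / ee.
pose m1 := 18 * (r * v) / ee.
have m00 : 0 < m0.
  by rewrite divr_gt0// addr_gt0// mulr_gt0// ?exprn_gt0// mulr_gt0.
have De : D <= eps / 6 * m0.
  have -> : eps / 6 * m0 = (18 * (r * v) + 28 * r ^+ 2) / 6 / eta.
    by rewrite /m0 /ee; field; rewrite !gt_eqF.
  rewrite /D ler_pM2r ?invr_gt0//.
  have : r * r <= r * v by rewrite ler_pM2l.
  by rewrite expr2; have := mulr_gt0 r0 r0; lra.
have Dm1 : D <= m1 * (m0 * w).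
  have -> : m1 * (m0 * w) = (r * (18 * v + 28 * r) / 4 / v) * (r / eta).
    by rewrite /m1 /m0 /w /ee; field; rewrite !gt_eqF.
  have -> : D = 64 / 9 * r * (r / eta) by rewrite /D; ring.
  rewrite ler_pM2r ?divr_gt0// ler_pdivlMr// mulrAC.
  have : 0 <= r * (18 * v + 28 * r - 256 / 9 * v).
    by apply: mulr_ge0; [exact: ltW r0|lra].
  by lra.
have [t|t tgood tle] := @good_index_bound R u D D0 u0 uD
    (fun t => pam_stop_cond a b C eps fs gs ls t.+1) (eps / 6) w m0 m1 w0 m00 De Dm1.
  move=> ut; have := inc t.
  have [hx|hx] := leP (xt t) (eps / (6 * v)); last first.
    move=> h; right; apply: le_trans h.
    apply: (@le_trans _ _ (eta / 2 * xt t ^+ 2)).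
      have -> : w = eta / 2 * (eps / (6 * v)) ^+ 2.
        by rewrite /w; field; rewrite gt_eqF.
      rewrite ler_pM2l ?divr_gt0// lerXn2r ?nnegrE ?(ltW hx)//.
        by rewrite divr_ge0 ?mulr_ge0 ?(ltW en) ?(ltW v0).
      by rewrite (le_trans _ (ltW hx))// divr_ge0 ?mulr_ge0 ?ltW.
    by rewrite lerDl mulr_ge0 ?sqr_ge0// divr_ge0 ?sqr_ge0 ?mulr_ge0 ?(ltW eta0).
  have [hy|hy] := leP (yt t) (eta * eps / (18 * c ^+ 2)); last first.
    move=> h; right; apply: le_trans h.
    apply: (@le_trans _ _ (c ^+ 2 / (2 * eta) * yt t ^+ 2)).
      apply: (@le_trans _ _ (c ^+ 2 / (2 * eta) * (eta * eps / (18 * c ^+ 2)) ^+ 2)).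
        have -> : c ^+ 2 / (2 * eta) * (eta * eps / (18 * c ^+ 2)) ^+ 2 =
            eta * eps ^+ 2 / (72 * (3 * c) ^+ 2).
          by field; rewrite !gt_eqF.
        apply: ler_wpM2l; first by rewrite mulr_ge0 ?sqr_ge0 ?(ltW eta0).
        rewrite lef_pV2 ?posrE ?mulr_gt0 ?exprn_gt0// ler_pM2l//.
        by rewrite lerXn2r ?nnegrE ?(ltW v0) ?(ltW c3).
      rewrite ler_pM2l ?divr_gt0 ?exprn_gt0 ?mulr_gt0//.
      by rewrite lerXn2r ?nnegrE ?(ltW hy) ?norm2_ge0// ltW// divr_gt0 ?mulr_gt0 ?exprn_gt0.
    by rewrite lerDr mulr_ge0 ?sqr_ge0// divr_ge0 ?(ltW eta0).
  by move=> _; left; split; rewrite ?pam_planE ?vE.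
exists t => //; apply: (le_trans tle); rewrite -/ee.
have -> : 36 * (r * v) / ee = m1 + m1 by rewrite /m1; field; rewrite gt_eqF.
have -> : m0 = m1 + 28 * r ^+ 2 / ee by rewrite /m0 /m1; field; rewrite gt_eqF.
have : 0 < 648 * c ^+ 2 / ee.
  by apply: divr_gt0 ee0; apply: mulr_gt0; [exact: ltr0n|exact: exprn_gt0].
by lra.
Qed.

(** Substitutes [l k * C k i j = f i + g j - eta * expo]; the potentials only see the marginals of
    [w]. *)
Lemma ell_expoE f g l (w : 'I_N -> 'M[R]_n) :
  ell C w l = inner f (rsum (\sum_k w k)) + inner g (csum (\sum_k w k))
    - eta * \sum_k \sum_i \sum_j w k i j * expo f g l (k, (i, j)).
Proof.
have -> : inner f (rsum (\sum_k w k)) = \sum_k \sum_i \sum_j w k i j * f i 0.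
  rewrite inner_vecE exchange_big; apply: eq_bigr => i _ /=.
  rewrite rsum_sumE mulr_sumr; apply: eq_bigr => k _; rewrite mulr_sumr.
  by apply: eq_bigr => j _; rewrite mulrC.
have -> : inner g (csum (\sum_k w k)) = \sum_k \sum_i \sum_j w k i j * g j 0.
  under [RHS]eq_bigr do rewrite exchange_big.
  rewrite inner_vecE exchange_big; apply: eq_bigr => j _ /=.
  rewrite csum_sumE mulr_sumr; apply: eq_bigr => k _; rewrite mulr_sumr.
  by apply: eq_bigr => i _; rewrite mulrC.
rewrite -big_split mulr_sumr -sumrB /ell /=; apply: eq_bigr => k _.
rewrite -big_split !mulr_sumr -sumrB /=; apply: eq_bigr => i _.
rewrite -big_split !mulr_sumr -sumrB /=; apply: eq_bigr => j _.
by rewrite /expo /=; field; rewrite gt_eqF ?eta_gt0.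
Qed.

(** * Feasibility and optimality of the rounded output *)

Section Output.
Variables (t : nat) (pih : 'I_N -> 'M[R]_n) (ak bk : 'I_N -> 'cV[R]_n).

Local Notation p := (pam_plan a b C eps t.+1).
Local Notation lh := (pam_l a b C eps t).

Hypotheses (marg : margins p b ak bk)
           (round : forall k, pih k = round_plan (p k) (ak k) (bk k)).

Lemma pam_plan_gt0 k i j : 0 < p k i j.
Proof. by rewrite pam_planE zetaE expR_gt0. Qed.

Lemma pam_plan_col_mass : \sum_j b j 0 = \sum_j csum (\sum_k p k) j 0.
Proof. by rewrite pam_planE sum_cz mass_half sb.2. Qed.

Let inv : margins_inv p b bk.
Proof.
case: marg => _ reach _; apply: margins_reach_inv => //.
  by move=> k i j; rewrite ltW// pam_plan_gt0.
exact: pam_plan_col_mass.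
Qed.

Let bk0 k j : 0 <= bk k j 0. Proof. by case: marg. Qed.

Let pihE k : pih k = round_plan (p k) (rsum (p k)) (bk k).
Proof. by case: marg => + _ _; rewrite round => ->. Qed.

Let bk_mass k : \sum_j bk k j 0 = \sum_i rsum (p k) i 0.
Proof.
have [_ -> _] := inv.
under eq_bigr do rewrite csumE; under [RHS]eq_bigr do rewrite rsumE.
exact: exchange_big.
Qed.

Lemma pam_output_coupling : couplings a b pih.
Proof.
have rE k : rsum (pih k) = rsum (p k).
  rewrite pihE rsum_round_plan//; first exact: pam_plan_gt0.
have cE k : csum (pih k) = bk k.
  rewrite pihE csum_round_plan//; first exact: pam_plan_gt0.
split=> [k i j||].
- by rewrite pihE round_plan_ge0//; exact: pam_plan_gt0.
- rewrite -[RHS](rz_half t) -pam_planE; apply/matrixP => i i'.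
  rewrite ord1 !rsum_sumE; apply: eq_bigr => k _.
  by rewrite -!rsumE rE.
- apply/matrixP => j j'; have [i1 _ _] := inv.
  rewrite ord1 -i1 csum_sumE; apply: eq_bigr => k _.
  by rewrite -csumE cE.
Qed.

(** Each block is off by at most its own column discrepancies, and these add up without loss by the
    sign condition. *)
Lemma pam_output_dist : \sum_k \sum_i \sum_j `|pih k i j - p k i j| <= xt t.
Proof.
have -> : xt t = \sum_j `|b j 0 - csum (\sum_k p k) j 0|.
  by rewrite norm1_vecE pam_planE; apply: eq_bigr => j _; rewrite !mxE distrC.
under [leRHS]eq_bigr do rewrite -(margins_inv_dist _ inv).
rewrite [leRHS]exchange_big; apply: ler_sum => k _; rewrite pihE.
by apply: round_plan_dist_le => //; exact: pam_plan_gt0.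
Qed.

Lemma ell_output_le l : simplex l -> ell C pih l <= ell C p l + c * xt t.
Proof.
move=> sl; rewrite -lerBlDl -sumrB.
apply: le_trans (ler_wpM2l (ltW c0) pam_output_dist).
rewrite mulr_sumr; apply: ler_sum => k _; rewrite -mulrBr -innerBl.
rewrite /inner !mulr_sumr; apply: ler_sum => i _.
rewrite !mulr_sumr; apply: ler_sum => j _.
have /andP[l0 l1] := simplex_le1 k sl.
have -> : (pih k - p k) i j = pih k i j - p k i j by rewrite !mxE.
rewrite (le_trans (ler_norm _))// !normrM (ger0_norm l0) [leRHS]mulrC.
by rewrite -[leRHS]mul1r ler_pM ?mulr_ge0// ler_wpM2l ?le_cinf.
Qed.

Lemma ell_plan_le l : simplex l ->
  ell C p l <= ell C p lh + c * xt t + 3 * c ^+ 2 / eta * yt t.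
Proof.
move=> sl; rewrite -addrA -lerBlDl.
have -> : ell C p l - ell C p lh =
    \sum_k (l k 0 - lh k 0) * cost (ft t.+1) (gt t) lh k.
  by rewrite -sumrB pam_planE; apply: eq_bigr => k _; rewrite mulrBl.
exact: half_cost_gap_le.
Qed.

(* Both sides are compared with the potentials through
   [l k * C k i j = f i + g j - eta * ln (p k i j)]. *)
Lemma ell_plan_coupling_le pi' : couplings a b pi' ->
  ell C p lh <= ell C pi' lh + osc / 2 * xt t + eps / 3.
Proof.
move=> [pi0 pia pib].
rewrite (ell_expoE (ft t.+1) (gt t) lh p) (ell_expoE (ft t.+1) (gt t) lh pi').
rewrite pia pib pam_planE rz_half.
have h1 : inner (gt t) (cz (ft t.+1) (gt t) lh) - inner (gt t) b <= osc / 2 * xt t.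
  rewrite -innerBr; apply: inner_centered_le => //; first exact: pam_g_osc.
  under eq_bigr do rewrite mxE.
  rewrite big_split /= sum_cz mass_half; under eq_bigr do rewrite mxE.
  by rewrite sumrN sb.2 subrr.
pose e := expo (ft t.+1) (gt t) lh.
have p1 : \sum_x expR (e x) = 1 by rewrite -massE mass_half.
have h2 : - \sum_x expR (e x) * e x <= ln (n ^ 2 * N)%:R.
  have := entropy_le (fun x => expR_gt0 (e x)) p1.
  rewrite !card_prod !card_ord mulnC -mulnn.
  by under eq_bigr do rewrite expRK.
(* The weights sum to one, so each is at most 1 and its exponent is nonpositive. *)
have h3 : \sum_k \sum_i \sum_j pi' k i j * e (k, (i, j)) <= 0.
  apply: sumr_le0 => k _; apply: sumr_le0 => i _; apply: sumr_le0 => j _.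
  rewrite mulr_ge0_le0// -expR_le1 -p1 (bigD1 (k, (i, j)))//= lerDl.
  by rewrite sumr_ge0// => x _; exact: expR_ge0.
have h4 : \sum_k \sum_i \sum_j zeta (ft t.+1) (gt t) lh k i j * e (k, (i, j)) =
    \sum_x expR (e x) * e x.
  rewrite -(sum_triple (fun k i j => expR (e (k, (i, j))) * e (k, (i, j)))).
  apply: eq_bigr => k _; apply: eq_bigr => i _; apply: eq_bigr => j _.
  by rewrite zetaE.
rewrite -/e h4.
have := ler_wpM2l (ltW eta_gt0) h2; have := mulr_ge0_le0 (ltW eta_gt0) h3.
have := eta_ln_size_le; move: h1 {h2 h3 h4}.
move: (\sum_x expR (e x) * e x) (\sum_k \sum_i \sum_j pi' k i j * e (k, (i, j))).
move: (inner (ft t.+1) a) (inner (gt t) b) (inner (gt t) (cz _ _ _)) (xt t) => *.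
by lra.
Qed.

Lemma pam_output_eps_optimal :
  xt t <= eps / (6 * (6 * c - eta * iota_min b)) ->
  yt t <= eta * eps / (18 * c ^+ 2) ->
  eps_optimal C a b eps pih lh.
Proof.
move=> hx hy; split; [exact: pam_output_coupling|exact: simplex_pam_l|].
have eta0 := eta_gt0; have cn := c0; have en := e0; have U2 := osc_ge.
pose x := xt t; pose y := yt t.
have x0 : 0 <= x by rewrite /x norm1_vecE sumr_ge0.
have v0 : 0 < 6 * c - eta * iota_min b by lra.
have hx' : (6 * c - eta * iota_min b) * x <= eps / 6.
  move: hx; rewrite -/x ler_pdivlMr ?mulr_gt0//; lra.
have hy' : 3 * c ^+ 2 / eta * y <= eps / 6.
  have -> : eps / 6 = 3 * c ^+ 2 / eta * (eta * eps / (18 * c ^+ 2)).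
    by field; rewrite !gt_eqF.
  by rewrite ler_wpM2l// ltW// divr_gt0// mulr_gt0// exprn_gt0//.
(* One [c * x] comes from rounding, the other from replacing [l] by [lh]. With [infP] the gap is at
   most [(osc + 4 * c) * x / 2 + eps / 6 + eps / 3], and the first term is at most [eps / 12]. *)
have supP : sup [set ell C pih l' | l' in @simplex R N] <=
    ell C p lh + (c * x + c * x + eps / 6).
  apply: ge_sup; first by exists (ell C pih lh), lh => //; exact: simplex_pam_l.
  move=> _ [l sl <-]; have := ell_output_le sl; have := ell_plan_le sl.
  by rewrite -/x -/y; move: hy'; lra.
have infP : ell C p lh - (osc / 2 * x + eps / 3) <=
    inf [set ell C pi' lh | pi' in couplings a b].
  apply: lb_le_inf; first by exists (ell C pih lh), pih => //; exact: pam_output_coupling.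
  by move=> _ [pi' cpi <-]; have := ell_plan_coupling_le cpi; rewrite -/x; lra.
have := mulr_ge0 (ltW cn) x0.
move: supP infP hx' {hx hy hy'}.
have -> : (6 * c - eta * iota_min b) * x = osc * x + 4 * (c * x) by ring.
have : 0 <= osc * x by rewrite mulr_ge0//; lra.
have -> : osc / 2 * x = osc * x / 2 by ring.
by move: (sup _) (inf _) (ell _ _ _) (osc * x) (c * x) en => *; lra.
Qed.

End Output.

Lemma pam_output_exists t : exists pih lh, pam_output a b C eps t.+1 pih lh.
Proof.
have [bk rbk bk0] := @margins_exist _ _ _ (pam_plan a b C eps t.+1) b N0
  (fun k i j => ltW (pam_plan_gt0 t k i j)) b0 (pam_plan_col_mass t).
eexists; exists (lt t), (fun k => rsum (pam_plan a b C eps t.+1 k)), bk.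
by split.
Qed.

(** * Orders of magnitude of [gamma0] and [Tbound] *)

Lemma gamma0_le : gamma0 b C eps <= (c ^+ 2)^-1.
Proof.
have c2 : 0 < c ^+ 2 by rewrite exprn_gt0.
rewrite ge_min; apply/orP; right.
by rewrite lef_pV2 ?posrE ?mulr_gt0//; lra.
Qed.

Lemma Tbound_le : eps <= c ->
  Tbound b C eps <= (5 + (64 * (6 - iota_min b) ^+ 2 + 648) *
    (3 * (ln (n ^ 2 * N)%:R + 1))) * (c ^+ 2 / eps ^+ 2).
Proof.
move=> ec; set L := 3 * _; set M := 6 - _.
have L1 : 1 <= L by rewrite /L; have := ln_size_ge0; lra.
have L0 : 0 < L by lra.
have [r [r0 Ur cr rv] gr] := gamma0_radius.
(* As [L >= 1] and [eps <= c], the minimum defining [eta] is its first term, so [1 / (eta * eps)] is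
   of order [eps ^- 2]. *)
have etaE : eta = eps / L.
  apply/min_idPl; rewrite ler_pdivrMr//.
  by rewrite (le_trans ec)// ler_peMr// ltW.
have vM : osc + 4 * c <= M * c.
  have := ler_wnM2l iota_min_le0 eta_le_cinf; rewrite /M; lra.
rewrite (TboundE r0 gr).
have ? := c0; have ? := e0.
have r2 : r ^+ 2 <= M ^+ 2 * c ^+ 2.
  by rewrite -exprMn lerXn2r ?nnegrE//; lra.
have rv2 : r * (osc + 4 * c) <= M ^+ 2 * c ^+ 2.
  by rewrite -exprMn expr2 ler_pM//; lra.
have q1 : 1 <= c ^+ 2 / eps ^+ 2.
  by rewrite ler_pdivlMr ?exprn_gt0// mul1r lerXn2r ?nnegrE//; lra.
have le0 : 0 <= L / eps ^+ 2 by rewrite divr_ge0 ?sqr_ge0// ltW.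
have iE : (eta * eps)^-1 = L / eps ^+ 2.
  by rewrite etaE; field; rewrite !gt_eqF.
rewrite !iE; have := ler_wpM2r le0 r2; have := ler_wpM2r le0 rv2.
have -> : (5 + (64 * M ^+ 2 + 648) * L) * (c ^+ 2 / eps ^+ 2) =
  5 * (c ^+ 2 / eps ^+ 2) + 64 * (M ^+ 2 * c ^+ 2 * (L / eps ^+ 2))
  + 648 * c ^+ 2 * (L / eps ^+ 2) by ring.
lra.
Qed.

End Updates.

(* If [a i = 0] then lowering [f i] decreases the mass for free. *)
Lemma maximizer_marginal_gt0 a b fs gs ls : simplex a ->
  dualF_maximizer a b C eps fs gs ls -> forall i, 0 < a i 0.
Proof.
move=> [a0 _] [sl maxF] i; rewrite lt_def a0 andbT; apply/eqP => ai.
have eta0 := eta_gt0.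
have := maxF (fs - delta_mx i 0) gs ls sl; rewrite /dualF leNgt => /negP; apply.
have -> : inner (fs - delta_mx i 0) a = inner fs a.
  rewrite innerBl [X in _ - X](_ : _ = 0) ?subr0// inner_vecE.
  apply: big1 => i' _; rewrite mxE eqxx andbT.
  by have [->|_] := eqVneq i' i; rewrite ?ai ?mulr0// mul0r.
rewrite ltrD2r ltrD2l ltrN2 ltr_pM2l// ltr_ln ?posrE ?mass_gt0// !massE.
pose x0 : 'I_N * ('I_n * 'I_n) := (Ordinal N0, (i, Ordinal n0)).
rewrite (bigD1 x0)//= [ltRHS](bigD1 x0)//= ltr_leD//.
  rewrite ltr_expR /expo !mxE /= ltr_pM2r ?invr_gt0// eqxx /=; lra.
apply: ler_sum => x _; rewrite ler_expR /expo !mxE /= ler_pM2r ?invr_gt0//.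
by case: (_ && _) => /=; lra.
Qed.

End DualFunction.

Theorem theorem12 (R : realType) (n N : nat) (hn : (1 <= n)%N) (hN : (1 <= N)%N)
    (b : 'cV[R]_n) (hb : simplex b) (hb0 : forall i, 0 < b i 0) :
  (exists K : R, forall (C : 'I_N -> 'M[R]_n) (eps : R),
     0 < cinf C -> 0 < eps ->
     gamma0 b C eps <= K * (cinf C ^+ 2)^-1 /\
     (eps <= cinf C -> Tbound b C eps <= K * (cinf C ^+ 2 / eps ^+ 2))) /\
  (forall (a : 'cV[R]_n) (C : 'I_N -> 'M[R]_n) (eps : R)
          (fs gs : 'cV[R]_n) (ls : 'cV[R]_N),
     simplex a -> 0 < cinf C -> 0 < eps ->
     dualF_maximizer a b C eps fs gs ls ->
     exists S : nat,
       [/\ pam_stops_at a b C eps fs gs ls S,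
           S%:R <= Tbound b C eps,
           exists pih lh, pam_output a b C eps S pih lh &
           forall pih lh, pam_output a b C eps S pih lh ->
             eps_optimal C a b eps pih lh]).
Proof.
split.
  (* The constant from [Tbound_le]; being at least 1, it also serves for [gamma0_le]. *)
  exists (5 + (64 * (6 - iota_min b) ^+ 2 + 648) *
    (3 * (ln (n ^ 2 * N)%:R + 1))) => C eps c0 e0; split; last exact: Tbound_le.
  apply: le_trans (gamma0_le _ _ _) _ => //.
  apply: ler_peMl; first by rewrite invr_ge0 sqr_ge0.
  have L0 : 0 <= 3 * (ln (n ^ 2 * N)%:R + 1) :> R.
    by have := @ln_size_ge0 R n N hn hN; lra.
  have M0 := mulr_ge0 (ler0n R 64) (sqr_ge0 (6 - iota_min b)).
  have := mulr_ge0 (addr_ge0 M0 (ler0n R 648)) L0; lra.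
move=> a C eps fs gs ls sa c0 e0 max.
(* The existence of a maximizer supplies the positivity of [a] used by the [f] update. *)
have a0 := maximizer_marginal_gt0 hn hN c0 e0 sa max.
have [t0 stop0 t0T] := stop_exists hn hN c0 e0 sa a0 hb hb0 max.
pose P S := (0 < S)%N && `[< pam_stop_cond a b C eps fs gs ls S >].
have exP : exists S, P S by exists t0.+1; apply/asboolP.
case: (ex_minnP exP) => -[//|t] /andP[_ /asboolP stop] minS.
exists t.+1; split.
- split=> // S' /andP[S0 S't] stop'.
  by have := minS S'; rewrite /P S0 leqNgt S't => /(_ (asboolT stop')).
- by rewrite (le_trans _ t0T)// ler_nat; apply: minS; apply/asboolP.
- exact: pam_output_exists.
- move=> pih lh [ak [bk [marg rnd ->]]].
  have [hx hy _] := stop.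
  rewrite pam_planE// in hx.
  exact: (pam_output_eps_optimal hn hN c0 e0 sa a0 hb hb0 marg rnd hx hy).
Qed.
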